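(* Let $v$ be a finite dimensional unitary corepresentation of a Woronowicz algebra. If the Popa system $\mathrm{End}(v^{\otimes[i,j]})_{0\le i\le j<\infty}$ is amenable then its index is the square of an integer.
   Context: **Woronowicz algebras.** Consider pairs $(A,u)$, $A$ a unital $C^*$-algebra and $u\in M_n(A)$ unitary, with: (w1) the coefficients of $u$ generate a dense $*$-subalgebra $A_s\subset A$; (w2) there is a $C^*$-morphism $\delta:A\to A\otimes_{\min}A$ with $\delta(u_{ij})=\sum_k u_{ik}\otimes u_{kj}$; (w3) there is a linear antimultiplicative map $\kappa:A_s\to A_s$ with $\kappa(\kappa(a^* )^* )=a$ for all $a\in A_s$ and $(\mathrm{id}\otimes\kappa)u=u^{-1}$. Woronowicz algebras are the inductive limits of such pairs; as only one corepresentation is considered, they may be supposed to come from a pair $(A,u)$ satisfying (w1), (w2) and (w3). $A_s$ is a Hopf $*$-algebra. A finite dimensional unitary corepresentation is a unitary $v\in\mathcal L(H)\otimes A_s$ with $(\mathrm{id}\otimes\delta)v=v_{12}v_{13}$; $\mathrm{Hom}(v,w)=\{T:(T\otimes1)v=w(T\otimes1)\}$, $\mathrm{End}(v)=\mathrm{Hom}(v,v)$, $v\otimes w=v_{13}w_{23}$. **Modular data.** $h$ is the Haar measure (unique bi-invariant state). With $f*a=(\mathrm{id}\otimes f)\delta(a)$, $a*f=(f\otimes\mathrm{id})\delta(a)$, $f*g=(f\otimes g)\delta$, let $\{f_z\}_{z\in\mathbb C}$ be Woronowicz's canonical characters of $A_s$ (the unique family, entire of exponential growth on the right half-plane in $z$,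 with $f_z*f_{z'}=f_{z+z'}$, $f_0=$ counit, $f_z\kappa(a)=f_{-z}(a)$, $f_z(a^* )=\overline{f_{-\bar z}(a)}$, $\kappa^2(a)=f_{-1}*a*f_1$, $h(ab)=h(b(f_1*a*f_1))$). $Q_v=(\mathrm{id}\otimes f_{1/2})v$ (positive invertible), $d(v)=\mathrm{Tr}(Q_v^2)=\mathrm{Tr}(Q_v^{-2})$, and $\hat v=Q_v^t\bar v(Q_v^t)^{-1}$ is the canonical dual ($\bar v$ = complex conjugate of $v$, $t$ = transposition $\mathcal L(H)\to\mathcal L(\bar H)$). **The Popa system of $v$.** For $0\le i\le j$, $[i,j]$ is the word whose letters in positions $i+1,\dots,j$ are $\alpha$ at odd positions and $\beta$ at even positions; $v^{\otimes[i,j]}$ is obtained by replacing $\alpha$ by $v$ and $\beta$ by $\hat v$ and taking tensor products. The lattice $A_{ij}=\mathrm{End}(v^{\otimes[i,j]})$, with inclusions $x\mapsto\mathrm{id}\otimes x\otimes\mathrm{id}$, is a Popa $\lambda$-system (standard $\lambda$-lattice) with $\lambda=d(v)^{-2}$, for the traces $d(w)^{-1}\mathrm{Tr}(Q_w^2\,\cdot)$, $w=v^{\otimes[i,j]}$, and suitable Jones projections. The index of a Popa $\lambda$-system is $\lambda^{-1}$, so here it is $d(v)^2$. **Amenability.** A Popa $\lambda$-system $(A_{ij})$ is amenable if the norm of its principal graph (operator norm of its bipartite adjacency matrix) equals $\lambda^{-1/2}$. The principal graph is the bipartite graph obtained from the Bratteli diagram of the tower $A_{00}\subset A_{01}\subset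 A_{02}\subset\cdots$ by deleting, at each level, the part which is the reflection of the previous level. For the system of $v$ its even vertices are the classes of irreducible subcorepresentations of the $(v\otimes\hat v)^{\otimes k}$, its odd vertices those of the $(v\otimes\hat v)^{\otimes k}\otimes v$, $k\ge0$, with $\dim\mathrm{Hom}(r\otimes v,p)$ edges between an even vertex $r$ and an odd vertex $p$. *)

(* Defs.v *)
From HB Require Import structures.
From mathcomp Require Import all_boot all_order all_algebra.
From mathcomp Require Import all_classical all_reals all_analysis.
From mathcomp Require Import complex mxtens.
Set Implicit Arguments.
Unset Strict Implicit.
Unset Printing Implicit Defensive.
Import Order.TTheory GRing.Theory Num.Theory.
Import numFieldNormedType.Exports.
Local Open Scope classical_set_scope.
Local Open Scope ring_scope.
Local Open Scope complex_scope.

(* Unital C*-algebras.  [algType] makes them non-zero.  The library has no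
   structure joining rings that are not numeric domains with normed modules, so
   the norm (with values in the non-negative part of K, as in the library) and
   the completeness for it are part of the structure. *)

HB.mixin Record isCStarAlgebra (K : numClosedFieldType) A
    of GRing.Algebra K A := {
  star : A -> A;
  cnorm : A -> K;
  starK : involutive star;
  starD : {morph star : x y / x + y};
  starZ : forall (c : K) (x : A), star (c *: x) = Num.conj c *: star x;
  starM : forall x y : A, star (x * y) = star y * star x;
  cnorm_ge0 : forall x : A, 0 <= cnorm x;
  cnorm0_eq0 : forall x : A, cnorm x = 0 -> x = 0;
  ler_cnormD : forall x y : A, cnorm (x + y) <= cnorm x + cnorm y;
  cnormZ : forall (c : K) (x : A), cnorm (c *: x) = `|c| * cnorm x;
  ler_cnormM : forall x y : A, cnorm (x * y) <= cnorm x * cnorm y;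
  cnorm_starM : forall x : A, cnorm (star x * x) = cnorm x ^+ 2;
  cnorm_complete : forall s : nat -> A,
    (forall e : K, 0 < e -> exists N, forall p q, (N <= p)%N -> (N <= q)%N ->
       cnorm (s p - s q) < e) ->
    exists l, forall e : K, 0 < e -> exists N, forall p, (N <= p)%N ->
       cnorm (s p - l) < e
}.

#[short(type="cstarAlgType")]
HB.structure Definition CStarAlgebra (K : numClosedFieldType) :=
  { A of isCStarAlgebra K A & GRing.Algebra K A }.

Definition cdense (K : numClosedFieldType) (A : cstarAlgType K)
  (X : set A) : Prop :=
  forall a (e : K), 0 < e -> exists2 x, X x & cnorm (a - x) < e.

Definition star_hom (K : numClosedFieldType) (A B : cstarAlgType K)
  (f : A -> B) : Prop := {morph f : x / star x}.

Section MinimalTensorProduct.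
Context {K : numClosedFieldType} (A1 A2 : cstarAlgType K).

Definition tens (B : cstarAlgType K) (i1 : A1 -> B) (i2 : A2 -> B)
  (s : seq (A1 * A2)) : B := \sum_(x <- s) i1 x.1 * i2 x.2.

(* [i1], [i2] induce an injective unital *-morphism from the algebraic tensor
   product A1 (.) A2 to B; pulling back the norm of B gives a C*-norm on
   A1 (.) A2, and all C*-norms on A1 (.) A2 arise in this way. *)
Definition algebraic_tensor (B : cstarAlgType K)
    (i1 : {lrmorphism A1 -> B}) (i2 : {lrmorphism A2 -> B}) : Prop :=
  [/\ star_hom i1, star_hom i2,
      forall a b, i1 a * i2 b = i2 b * i1 a
    & forall n (a : 'I_n -> A1) (b : 'I_n -> A2),
        (forall c : 'I_n -> K, \sum_k c k *: a k = 0 -> forall k, c k = 0) ->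
        \sum_k i1 (a k) * i2 (b k) = 0 -> forall k, b k = 0].

(* B is the completion of A1 (.) A2 for its smallest C*-norm. *)
Definition is_min_tensor (B : cstarAlgType K)
    (i1 : {lrmorphism A1 -> B}) (i2 : {lrmorphism A2 -> B}) : Prop :=
  [/\ algebraic_tensor i1 i2,
      cdense (range (tens i1 i2))
    & forall (D : cstarAlgType K)
             (j1 : {lrmorphism A1 -> D}) (j2 : {lrmorphism A2 -> D}),
        algebraic_tensor j1 j2 ->
        forall s, cnorm (tens i1 i2 s) <= cnorm (tens j1 j2 s)].

End MinimalTensorProduct.

Inductive star_alg_span (K : numClosedFieldType) (A : cstarAlgType K)
    (X : set A) : A -> Prop :=
| SpanGen x : X x -> star_alg_span X x
| SpanOne : star_alg_span X 1
| SpanAdd x y : star_alg_span X x -> star_alg_span X y ->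
    star_alg_span X (x + y)
| SpanScale (c : K) x : star_alg_span X x -> star_alg_span X (c *: x)
| SpanMul x y : star_alg_span X x -> star_alg_span X y ->
    star_alg_span X (x * y)
| SpanStar x : star_alg_span X x -> star_alg_span X (star x).

Definition star_mx (K : numClosedFieldType) (A : cstarAlgType K) m n
  (v : 'M[A]_(m, n)) : 'M[A]_(n, m) := (map_mx star v)^T.

Definition unitary_mx (K : numClosedFieldType) (A : cstarAlgType K) m
  (v : 'M[A]_m) : Prop := v *m star_mx v = 1%:M /\ star_mx v *m v = 1%:M.

(* The antipode [wkappa] is a map A_s -> A_s; it is represented by a function
   on the whole algebra whose values outside A_s are never used. *)
Record woronowicz_algebra (R : realType) := WoronowiczAlgebra {
  walg : cstarAlgType R[i];
  wdim : nat;
  wu : 'M[walg]_wdim;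
  wtensor : cstarAlgType R[i];
  winl : {lrmorphism walg -> wtensor};
  winr : {lrmorphism walg -> wtensor};
  wdelta : {lrmorphism walg -> wtensor};
  wkappa : walg -> walg;
  wcoef : set walg := star_alg_span (fun a => exists i j, a = wu i j);
  wu_unitary : unitary_mx wu;
  wcoef_dense : cdense wcoef;
  wtensorP : is_min_tensor winl winr;
  wdelta_star : star_hom wdelta;
  wdeltaE : forall i j,
    wdelta (wu i j) = \sum_k winl (wu i k) * winr (wu k j);
  wkappa_coef : forall a, wcoef a -> wcoef (wkappa a);
  wkappa_linear : forall (c : R[i]) a b, wcoef a -> wcoef b ->
    wkappa (c *: a + b) = c *: wkappa a + wkappa b;
  wkappaM : forall a b, wcoef a -> wcoef b ->
    wkappa (a * b) = wkappa b * wkappa a;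
  wkappa_star : forall a, wcoef a -> wkappa (star (wkappa (star a))) = a;
  (* u^-1 is the adjoint of u *)
  wkappa_u : map_mx wkappa wu = star_mx wu
}.

Section ModularData.
Context {R : realType} (W : woronowicz_algebra R).
Let C := R[i].
Let A := walg W.

(* A finite expansion of delta(a) in A_s (.) A_s; one exists for a in A_s, and
   the convolutions below do not depend on the one chosen. *)
Definition comult (a : A) : seq (A * A) :=
  xget [::] [set s : seq (A * A) |
    (forall x, x \in s -> wcoef x.1 /\ wcoef x.2) /\
    wdelta W a = tens (winl W) (winr W) s].

(* f * a = (id (x) f) delta(a) *)
Definition conv_l (f : A -> C) (a : A) : A := \sum_(x <- comult a) f x.2 *: x.1.
(* a * f = (f (x) id) delta(a) *)
Definition conv_r (a : A) (f : A -> C) : A := \sum_(x <- comult a) f x.1 *: x.2.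
Definition conv (f g : A -> C) (a : A) : C :=
  \sum_(x <- comult a) f x.1 * g x.2.

(* The continuous slice map (id (x) h), resp. (h (x) id), sends t to b: it is
   the closure of its restriction to the algebraic tensor product. *)
Definition slice_r (h : A -> C) (t : wtensor W) (b : A) : Prop :=
  forall e : C, 0 < e -> exists2 s : seq (A * A),
    cnorm (t - tens (winl W) (winr W) s) < e &
    cnorm (b - \sum_(x <- s) h x.2 *: x.1) < e.
Definition slice_l (h : A -> C) (t : wtensor W) (b : A) : Prop :=
  forall e : C, 0 < e -> exists2 s : seq (A * A),
    cnorm (t - tens (winl W) (winr W) s) < e &
    cnorm (b - \sum_(x <- s) h x.1 *: x.2) < e.

Definition is_haar (h : {scalar A}) : Prop :=
  [/\ h 1 = 1,
      forall a, 0 <= h (star a * a),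
      forall a, slice_r h (wdelta W a) (h a)%:A
    & forall a, slice_l h (wdelta W a) (h a)%:A].

Definition is_character (f : A -> C) : Prop :=
  [/\ f 1 = 1,
      forall (c : C) a b, wcoef a -> wcoef b -> f (c *: a + b) = c * f a + f b
    & forall a b, wcoef a -> wcoef b -> f (a * b) = f a * f b].

Definition entire (g : C -> C) : Prop :=
  forall z : C, derivable (g : C^o -> C^o) z 1.

Definition exp_growth_right (g : C -> C) : Prop :=
  exists M mu : R, forall z : C, 0 < complex.Re z ->
    `|g z| <= (M * expR (mu * complex.Re z))%:C.

(* As for the antipode, only the values of [f z] on A_s matter. *)
Definition is_woronowicz_characters (h : {scalar A}) (f : C -> A -> C) : Prop :=
  (forall z, is_character (f z)) /\
  (forall a, wcoef a ->
    [/\ entire (f ^~ a),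
        exp_growth_right (f ^~ a),
        forall z z', conv (f z) (f z') a = f (z + z') a,
        conv_l (f 0) a = a
      & conv_r a (f 0) = a] /\
    [/\ forall z, f z (wkappa a) = f (- z) a,
        forall z, f z (star a) = Num.conj (f (- Num.conj z) a),
        wkappa (wkappa a) = conv_l (f (- 1)) (conv_r a (f 1))
      & forall b, wcoef b ->
          h (a * b) = h (b * conv_l (f 1) (conv_r a (f 1)))]).

Definition unitary_corep m (v : 'M[A]_m) : Prop :=
  [/\ forall i j, wcoef (v i j),
      unitary_mx v
    & forall i j, wdelta W (v i j) = \sum_k winl W (v i k) * winr W (v k j)].

End ModularData.

Definition adj_mx (K : numClosedFieldType) m n (T : 'M[K]_(m, n)) :
  'M[K]_(n, m) := (map_mx Num.conj T)^T.

Definition scal_mx (K : numClosedFieldType) (A : cstarAlgType K) m n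
  (T : 'M[K]_(m, n)) : 'M[A]_(m, n) := map_mx (fun c : K => c%:A) T.

(* Lattices of finite dimensional C*-algebras with the data of a Popa
   lambda-system.  A_ij is a *-algebra [alg i j] of operators on
   C^(hdim i j); [incl i j k l] is the inclusion of A_ij in A_kl, where only
   k <= i <= j <= l is relevant; [jones i] is the Jones projection of
   A_(i,i+2).  The axioms of Popa are not part of the structure: the index, the
   principal graph and amenability depend on the data only. *)

Record lambda_system (R : realType) := LambdaSystem {
  lam : R;
  hdim : nat -> nat -> nat;
  alg : forall i j, set 'M[R[i]]_(hdim i j);
  incl : forall i j k l, 'M[R[i]]_(hdim i j) -> 'M[R[i]]_(hdim k l);
  trace : forall i j, 'M[R[i]]_(hdim i j) -> R[i];
  jones : forall i, 'M[R[i]]_(hdim i i.+2)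
}.
Arguments incl {R} P {i j} k l x : rename.
Arguments alg {R} P i j _ : rename.
Arguments trace {R} P {i j} x : rename.
Arguments jones {R} P i : rename.

Section Projections.
Context {K : numClosedFieldType} {n : nat} (B : set 'M[K]_n).

Definition projections : set 'M[K]_n :=
  [set p | [/\ B p, p *m p = p & adj_mx p = p]].

Definition central_projections : set 'M[K]_n :=
  [set p | projections p /\ forall x, B x -> p *m x = x *m p].

Definition minimal_among (X : set 'M[K]_n) (p : 'M[K]_n) : Prop :=
  [/\ X p, p <> 0 & forall q, X q -> p *m q = q -> q = 0 \/ q = p].

Definition min_projection := minimal_among projections.
Definition min_central_projection := minimal_among central_projections.

End Projections.

Record bigraph := Bigraph {
  even_vertex : Type;
  odd_vertex : Type;
  edges : even_vertex -> odd_vertex -> nat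
}.

(* Operator norm l^2(odd) -> l^2(even) of the adjacency matrix, as the supremum
   of <x, M y> over finitely supported vectors x, y of norm at most 1. *)
Definition graph_norm (R : realType) (G : bigraph) : \bar R :=
  ereal_sup [set r%:E | r in [set r : R |
    exists k l (s : 'I_k -> even_vertex G) (t : 'I_l -> odd_vertex G)
           (x : 'I_k -> R) (y : 'I_l -> R),
      [/\ injective s, injective t,
          \sum_i x i ^+ 2 <= 1, \sum_j y j ^+ 2 <= 1
        & r = \sum_i \sum_j x i * (edges (s i) (t j))%:R * y j]]].

Section PrincipalGraph.
Context {R : realType} (P : lambda_system R).

(* A simple summand of A_0j is given by its minimal central projection. *)
Definition bratteli_vertex := {j : nat & 'M[R[i]]_(hdim P 0 j)}.

(* Multiplicity of the simple summand [a] of A_0j in the simple summand [b] of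
   A_(0,j+1): a minimal projection under [a] is, once cut down by [b], a sum of
   that many minimal projections of A_(0,j+1). *)
Definition bratteli_mult (a b : bratteli_vertex) : nat :=
  let j := tag a in let j' := tag b in
  if j' == j.+1 then
    xget 0%N [set k | exists (p : 'M[R[i]]_(hdim P 0 j))
                             (g : 'I_k -> 'M[R[i]]_(hdim P 0 j')),
      [/\ min_projection (alg P 0 j) p /\ tagged a *m p = p,
          forall t, min_projection (alg P 0 j') (g t),
          forall t t', t != t' -> g t *m g t' = 0
        & incl P 0 j' p *m tagged b = \sum_t g t]]
  else 0%N.

(* The part of level j+2 which is the reflection of level j consists of the
   summands of the ideal of A_(0,j+2) generated by the Jones projection (the
   basic construction of A_0j in A_(0,j+1)); the remaining summands are those
   annihilated by this projection. *)
Definition principal_vertex (a : bratteli_vertex) : Prop :=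
  min_central_projection (alg P 0 (tag a)) (tagged a) /\
  forall i, i.+2 = tag a -> tagged a *m incl P 0 (tag a) (jones P i) = 0.

Definition principal_graph : bigraph := {|
  even_vertex := {a : bratteli_vertex | principal_vertex a /\ ~~ odd (tag a)};
  odd_vertex := {b : bratteli_vertex | principal_vertex b /\ odd (tag b)};
  edges := fun a b =>
    (bratteli_mult (sval a) (sval b) + bratteli_mult (sval b) (sval a))%N
|}.

Definition popa_index : R := (lam P)^-1.

Definition amenable : Prop :=
  graph_norm R principal_graph = ((Num.sqrt (lam P))^-1)%:E.

End PrincipalGraph.

Section PopaSystem.
Context {R : realType} {A : cstarAlgType R[i]}.
Variables (f : R[i] -> A -> R[i]) (m : nat) (v : 'M[A]_m).
Let C := R[i].

Definition qmat n (w : 'M[A]_n) : 'M[C]_n := map_mx (f 2^-1) w.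

(* The trace is real, as qmat v is self-adjoint. *)
Definition qdim n (w : 'M[A]_n) : R := complex.Re (\tr (qmat w *m qmat w)).

(* The canonical dual, in the basis of the conjugate Hilbert space conjugate to
   the canonical basis of C^m. *)
Definition dual_corep : 'M[A]_m :=
  scal_mx A (qmat v)^T *m map_mx star v *m scal_mx A (invmx (qmat v)^T).

(* The letter in position p >= 1. *)
Definition letter (p : nat) : 'M[A]_m := if odd p then v else dual_corep.

(* m ^ (j - i), in a form for which tensoring on the right needs no cast *)
Fixpoint word_dim (i j : nat) : nat :=
  if j is j'.+1 then
    if (i <= j')%N then (word_dim i j' * m)%N else 1%N
  else 1%N.

(* v^{(x)[i,j]}; the tensor product v_13 w_23 has entries
   v_(a,c) w_(b,d) at ((a,b),(c,d)), so it is the Kronecker product. *)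
Fixpoint word_corep (i j : nat) : 'M[A]_(word_dim i j) :=
  match j return 'M[A]_(word_dim i j) with
  | 0 => 1%:M
  | j'.+1 =>
    if (i <= j')%N as b
      return 'M[A]_(if b then (word_dim i j' * m)%N else 1%N)
    then word_corep i j' *t letter j'.+1 else 1%:M
  end.

Definition corep_hom n p (w : 'M[A]_n) (w' : 'M[A]_p) : set 'M[C]_(p, n) :=
  [set T | scal_mx A T *m w = w' *m scal_mx A T].

(* x |-> id (x) x (x) id; [conform_mx] only identifies
   word_dim k i * word_dim i j * word_dim j l with word_dim k l. *)
Definition word_incl i j k l (x : 'M[C]_(word_dim i j)) :
    'M[C]_(word_dim k l) :=
  conform_mx 0 ((1%:M : 'M[C]_(word_dim k i)) *t x
                *t (1%:M : 'M[C]_(word_dim j l))).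

Definition word_trace i j (x : 'M[C]_(word_dim i j)) : C :=
  let Q := qmat (word_corep i j) in
  (\tr (Q *m Q))^-1 * \tr (Q *m Q *m x).

(* The vector fixed by v (x) v^, resp. v^ (x) v^^ = v^ (x) v: for w a letter,
   sum_(k,l) (Q_w)_kl e_k (x) e_l. *)
Definition fixed_vector (w : 'M[A]_m) : 'cV[C]_(m * m) :=
  \col_k qmat w (mxtens_unindex k).1 (mxtens_unindex k).2.

(* The orthogonal projection on the line of the fixed vector of
   v^{(x)[i,i+2]}; word_dim i i.+2 is m * m. *)
Definition word_jones i : 'M[C]_(word_dim i i.+2) :=
  let r := fixed_vector (letter i.+1) in
  conform_mx 0 (((adj_mx r *m r) 0 0)^-1 *: (r *m adj_mx r)).

Definition popa_system : lambda_system R := {|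
  lam := (qdim v ^+ 2)^-1;
  hdim := word_dim;
  alg := fun i j => corep_hom (word_corep i j) (word_corep i j);
  incl := word_incl;
  trace := word_trace;
  jones := word_jones
|}.

End PopaSystem.

(* Main.v *)
(* The index is d(v)^2, where d(v) = Tr Q^2 and Q = (id (x) f_{1/2}) v.  The
   modular property of the Haar measure gives Tr Q^2 = Tr Q^{-2}, so that
   0 <= Tr (Q - Q^{-1})^2 reads dim v <= d(v).  Conversely, the principal graph
   has norm at most dim v by Schur's test: give a vertex the dimension of the
   corresponding irreducible corepresentation, i.e. the trace of a minimal
   projection p under it.  The neighbours of this vertex, with multiplicity, are
   irreducible subcorepresentations of p (x) 1 with orthogonal ranges (for those
   one level lower, by Frobenius reciprocity), so their dimensions add up to at
   most dim v * Tr p.  For an amenable system the norm is d(v), and therefore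
   d(v) = dim v. *)
From mathcomp Require Import all_boot all_order all_algebra.
From mathcomp Require Import all_classical all_reals all_analysis.
From mathcomp Require Import complex mxtens ring lra.
Require Import Defs.
Set Implicit Arguments.
Unset Strict Implicit.
Unset Printing Implicit Defensive.
Import Order.TTheory GRing.Theory Num.Theory.
Local Open Scope classical_set_scope.
Local Open Scope ring_scope.
Local Open Scope complex_scope.

(** * Star-subalgebras of matrix algebras *)

(** The principal graph is given by projections in the algebras [End(w_j)], [w_j = v^{(x)[0,j]}], so
    weights and multiplicities are read off minimal projections; what makes this consistent is that
    minimal projections under the same minimal central one are equivalent. The delicate neighbours
    are those one level lower. Their multiplicity is counted by orthogonal minimal projections
    upstairs, and Frobenius reciprocity only returns intertwiners. That these have orthogonal ranges
    is detected by [Tr (Q^2 .)], which is a trace on every [End(w_j)] and is compatible with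
    reciprocity. Lower and upper neighbours do not overlap because a principal vertex is annihilated
    by the Jones projection, whose range is that of the reciprocity map. Reciprocity rests on the
    unitarity of the canonical dual and on the fixed vectors of two consecutive letters. Both come
    from [kappa^2(a) = f_{-1} * a * f_1], once the antipode identities, given by (w3) on [u], are
    extended to all of [A_s]. *)

Section Adjoint.
Context {K : numClosedFieldType}.

Lemma adj_mxK m n (x : 'M[K]_(m, n)) : adj_mx (adj_mx x) = x.
Proof. by apply/matrixP => i j; rewrite !mxE conjCK. Qed.

Lemma adj_mxM m n p (x : 'M[K]_(m, n)) (y : 'M[K]_(n, p)) :
  adj_mx (x *m y) = adj_mx y *m adj_mx x.
Proof. by rewrite /adj_mx map_mxM trmx_mul. Qed.

Lemma adj_mxD m n (x y : 'M[K]_(m, n)) : adj_mx (x + y) = adj_mx x + adj_mx y.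
Proof. by rewrite /adj_mx map_mxD linearD. Qed.

Lemma adj_mxN m n (x : 'M[K]_(m, n)) : adj_mx (- x) = - adj_mx x.
Proof. by rewrite /adj_mx map_mxN linearN. Qed.

Lemma adj_mxB m n (x y : 'M[K]_(m, n)) : adj_mx (x - y) = adj_mx x - adj_mx y.
Proof. by rewrite adj_mxD adj_mxN. Qed.

Lemma adj_mxZ m n c (x : 'M[K]_(m, n)) :
  adj_mx (c *: x) = Num.conj c *: adj_mx x.
Proof. by rewrite /adj_mx map_mxZ linearZ. Qed.

Lemma adj_mx0 m n : adj_mx (0 : 'M[K]_(m, n)) = 0.
Proof. by rewrite /adj_mx map_mx0 trmx0. Qed.

Lemma adj_mx1 n : adj_mx (1%:M : 'M[K]_n) = 1%:M.
Proof. by rewrite /adj_mx map_mx1 trmx1. Qed.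

Lemma adj_mx_sum m n (I : finType) (F : I -> 'M[K]_(m, n)) :
  adj_mx (\sum_i F i) = \sum_i adj_mx (F i).
Proof.
by apply: (big_morph (@adj_mx K m n)); [apply: adj_mxD | apply: adj_mx0].
Qed.

Lemma adj_mx_tens m n p q (x : 'M[K]_(m, n)) (y : 'M[K]_(p, q)) :
  adj_mx (x *t y) = adj_mx x *t adj_mx y.
Proof. by rewrite /adj_mx map_mxT trmx_tens. Qed.

Lemma mxtrace_mulmx_adj m n (x : 'M[K]_(m, n)) :
  \tr (x *m adj_mx x) = \sum_i \sum_j `|x i j| ^+ 2.
Proof.
by apply: eq_bigr => i _; rewrite mxE; apply: eq_bigr => j _; rewrite !mxE normCK.
Qed.

Lemma mxtrace_mulmx_adj_ge0 m n (x : 'M[K]_(m, n)) : 0 <= \tr (x *m adj_mx x).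
Proof.
rewrite mxtrace_mulmx_adj.
by apply: sumr_ge0 => i _; apply: sumr_ge0 => j _; rewrite exprn_ge0.
Qed.

Lemma mxtrace_mulmx_adj_eq0 m n (x : 'M[K]_(m, n)) :
  \tr (x *m adj_mx x) = 0 -> x = 0.
Proof.
move=> tr0; have sq_ge0 i j : 0 <= `|x i j| ^+ 2 by rewrite exprn_ge0.
apply/matrixP => i j; rewrite mxE; move: tr0; rewrite mxtrace_mulmx_adj => /eqP.
rewrite psumr_eq0; last by move=> k _; apply: sumr_ge0.
move=> /allP/(_ i (mem_index_enum _))/=; rewrite psumr_eq0//.
move=> /allP/(_ j (mem_index_enum _))/=.
by rewrite sqrf_eq0 normr_eq0 => /eqP.
Qed.

Lemma mulmx_adj_eq0 m n (x : 'M[K]_(m, n)) : x *m adj_mx x = 0 -> x = 0.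
Proof. by move=> x0; apply: mxtrace_mulmx_adj_eq0; rewrite x0 mxtrace0. Qed.

Lemma adj_mulmx_eq0 m n (x : 'M[K]_(m, n)) : adj_mx x *m x = 0 -> x = 0.
Proof.
move=> x0; rewrite -[x]adj_mxK [adj_mx x]mulmx_adj_eq0 ?adj_mx0//.
by rewrite adj_mxK.
Qed.

Lemma mxtrace_proj_ge0 n (p : 'M[K]_n) :
  p *m p = p -> adj_mx p = p -> 0 <= \tr p.
Proof. by move=> pp ap; rewrite -pp -{2}ap mxtrace_mulmx_adj_ge0. Qed.

Lemma mxtrace_proj_gt0 n (p : 'M[K]_n) :
  p *m p = p -> adj_mx p = p -> p <> 0 -> 0 < \tr p.
Proof.
move=> pp ap p0; rewrite lt_def mxtrace_proj_ge0// andbT.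
by apply/eqP => tr0; apply/p0/mxtrace_mulmx_adj_eq0; rewrite ap pp.
Qed.

End Adjoint.

Section StarSubalgebra.
Context {K : numClosedFieldType}.

Definition star_subalgebra n (B : set 'M[K]_n) : Prop :=
  [/\ B 1%:M, forall c x y, B x -> B y -> B (c *: x + y),
      forall x y, B x -> B y -> B (x *m y) & forall x, B x -> B (adj_mx x)].

Context {n : nat} {B : set 'M[K]_n} (subB : star_subalgebra B).

Lemma star_subalgebra1 : B 1%:M. Proof. by case: subB. Qed.

Lemma star_subalgebraM x y : B x -> B y -> B (x *m y).
Proof. by case: subB => _ _ + _; apply. Qed.

Lemma star_subalgebra_adj x : B x -> B (adj_mx x).
Proof. by case: subB => _ _ _; apply. Qed.

Lemma star_subalgebra0 : B 0.
Proof.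
case: subB => B1 BL _ _.
by rewrite -[0](addNr 1%:M) -scaleN1r; apply: BL.
Qed.

Lemma star_subalgebraZ c x : B x -> B (c *: x).
Proof.
move=> Bx; rewrite -[_ *: _]addr0.
by case: subB => _ BL _ _; apply: BL => //; apply: star_subalgebra0.
Qed.

Lemma star_subalgebraD x y : B x -> B y -> B (x + y).
Proof. by rewrite -{2}[x]scale1r; case: subB => _ + _ _; apply. Qed.

Lemma star_subalgebraB x y : B x -> B y -> B (x - y).
Proof.
move=> Bx By; apply: star_subalgebraD => //.
by rewrite -scaleN1r; apply: star_subalgebraZ.
Qed.

Lemma projections_compl p : projections B p -> projections B (1%:M - p).
Proof.
move=> [Bp pp ap]; split.
- by apply: star_subalgebraB => //; apply: star_subalgebra1.
- by rewrite mulmxBl !mulmxBr !mul1mx !mulmx1 pp subrr subr0.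
- by rewrite adj_mxB adj_mx1 ap.
Qed.

End StarSubalgebra.

Lemma star_subalgebra_horner (K : numClosedFieldType) n (B : set 'M[K]_n.+1)
    (h : 'M[K]_n.+1) (q : {poly K}) :
  star_subalgebra B -> B h -> B (horner_mx h q).
Proof.
move=> subB Bh; elim/poly_ind: q => [|q c IHq].
  by rewrite rmorph0; apply: star_subalgebra0.
rewrite rmorphD rmorphM /= horner_mx_X horner_mx_C.
apply: star_subalgebraD => //; first exact: star_subalgebraM.
by rewrite -scalemx1; apply: star_subalgebraZ => //; apply: star_subalgebra1.
Qed.

(* A self-adjoint h vanishes on ker h^k only if it vanishes on ker h, so the
   minimal polynomial of h has at most a simple root at 0. *)
Lemma support_projection (K : numClosedFieldType) n (B : set 'M[K]_n)
    (h : 'M[K]_n) :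
  star_subalgebra B -> B h -> adj_mx h = h ->
  exists y, [/\ B y, projections B (h *m y) & (h *m y) *m h = h].
Proof.
case: n B h => [|n] B h subB Bh ah.
  exists h; rewrite !thinmx0; split; rewrite ?mulmx0//.
  - exact: star_subalgebra0.
  - by split; rewrite ?mulmx0 ?adj_mx0//; apply: star_subalgebra0.
have kerX k x : h ^+ k.+1 *m x = 0 -> h *m x = 0.
  elim: k x => [|k IHk] x; first by rewrite expr1.
  rewrite exprSr -mulmxA => /IHk hhx.
  by apply: adj_mulmx_eq0; rewrite adj_mxM ah -mulmxA hhx mulmx0.
have [k [q q0 mhE]] := multiplicity_XsubC (mxminpoly h) 0.
rewrite monic_neq0 ?mxminpoly_monic//= in q0.
have hq : h *m horner_mx h q = 0.
  have := mx_root_minpoly h; rewrite mhE rmorphM rmorphXn /= subr0 horner_mx_X.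
  have qhC : horner_mx h q * h ^+ k = h ^+ k * horner_mx h q.
    by apply/commrX/comm_horner_mx.
  rewrite qhC; case: (k) => [|l]; last exact: kerX.
  by rewrite expr0 mul1r => ->; rewrite mulmx0.
have [c0 [q1 qE]] : exists c0, exists q1, q = q1 * 'X + c0%:P.
  by elim/poly_ind: (q) => [|q1 c _]; [exists 0, 0; rewrite mul0r addr0 | exists c, q1].
have c0N0 : c0 != 0.
  by move: q0; rewrite qE rootE hornerD hornerM hornerX hornerC mulr0 add0r.
(* With [q = q1 X + c0], the relation [h q(h) = 0] reads [h (h q1(h)) = - c0 h]; dividing by [- c0]
   makes [h y] a unit for [h]. *)
pose y := - c0^-1 *: horner_mx h q1.
have By : B y by apply: star_subalgebraZ => //; apply: star_subalgebra_horner.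
have hhy : h *m (h *m y) = h.
  have qhC : horner_mx h q1 * h = h * horner_mx h q1 by apply/comm_horner_mx.
  move: hq; rewrite qE rmorphD rmorphM /= horner_mx_X horner_mx_C qhC mulmxDr.
  move=> /eqP; rewrite addr_eq0 mul_mx_scalar => /eqP hqE.
  rewrite /y -!scalemxAr -[h *m horner_mx h q1]/(h * _) hqE scalerN scaleNr opprK.
  by rewrite scalerA mulVf// scale1r.
have ayh : adj_mx (h *m y) *m h = h by rewrite -{2}ah -adj_mxM hhy ah.
have sE : adj_mx (h *m y) *m (h *m y) = h *m y by rewrite mulmxA ayh.
have as_ : adj_mx (h *m y) = h *m y by rewrite -sE adj_mxM adj_mxK.
exists y; split => //; last by rewrite -{1}as_ ayh.
by split=> //; [apply: star_subalgebraM | rewrite -{1}as_].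
Qed.

Lemma idem_mulmx (K : pzRingType) n (x y : 'M[K]_n) :
  x *m x = x -> y *m y = y -> x *m y = y *m x -> x *m y *m (x *m y) = x *m y.
Proof.
by move=> xx yy xy; rewrite {2}xy mulmxA -[x *m y *m y]mulmxA yy xy -mulmxA xx.
Qed.

(** * Minimal and minimal central projections *)

Section MinimalProjections.
Context {K : numClosedFieldType} {n : nat} {B : set 'M[K]_n}.
Hypothesis subB : star_subalgebra B.

(* A matrix p x p has an eigenvector in the range of p; for the corresponding
   eigenvalue c, the support of p x p - c p is strictly smaller than p. *)
Lemma min_projection_corner p x :
  min_projection B p -> B x -> exists c, p *m x *m p = c *: p.
Proof.
move=> [[Bp pp ap] p0 minp] Bx; set h := p *m x *m p.
have hp : h *m p = h by rewrite /h -mulmxA pp.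
have ph : p *m h = h by rewrite /h !mulmxA pp.
(* [A] is the matrix of right multiplication by [h] on the row space of [p]; an eigenvector [u] of
   [A] gives the eigenvector [u V] of [h]. *)
pose V := row_base p; pose A := V *m h *m pinvmx V.
have AV : A *m V = V *m h.
  rewrite mulmxKpV// -hp mulmxA (submx_trans (submxMl _ _))//.
  by rewrite eq_row_base.
have Vp : V *m p = V.
  have /submxP[D VE] : (V <= p)%MS by rewrite eq_row_base.
  by rewrite VE -mulmxA pp.
have [c /eigenvalueP[u uA u0]] : exists c, eigenvalue A c.
  by apply: eigenvalue_closed; rewrite lt0n mxrank_eq0; apply/eqP.
have uV0 : u *m V != 0.
  by apply: contra u0 => /eqP uV0; rewrite -(mulmx_free_eq0 _ (row_base_free p)) uV0.
pose k := h - c *: p.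
have Bk : B k.
  apply: star_subalgebraB => //; last exact: star_subalgebraZ.
  by do 2!apply: star_subalgebraM => //.
have uVk : u *m V *m k = 0.
  rewrite mulmxBr -scalemxAr -[in _ *: _]mulmxA Vp -mulmxA -AV mulmxA uA.
  by rewrite -scalemxAl subrr.
have pk : p *m k = k by rewrite mulmxBr ph -scalemxAr pp.
(* This support lies under [p], so it is 0 or [p]. It is not [p]: it annihilates the row vector
   [u V], which [p] fixes. *)
have [||y [By sP skk]] := support_projection (h := k *m adj_mx k) subB.
- by apply: star_subalgebraM => //; apply: star_subalgebra_adj.
- by rewrite adj_mxM adj_mxK.
exists c; apply/eqP; rewrite -subr_eq0; apply/eqP.
have [|s0|sE] := minp _ sP.
- by rewrite !mulmxA pk.
- by apply: mulmx_adj_eq0; rewrite -skk s0 mul0mx.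
- have uVp : u *m V *m p = u *m V by rewrite -mulmxA Vp.
  move: (u *m V) uV0 uVk uVp => w w0 wk wp.
  by move: w0; rewrite -wp -sE !mulmxA wk !mul0mx eqxx.
Qed.

Lemma min_central_projection_orth z z' :
  min_central_projection B z -> min_central_projection B z' -> z <> z' ->
  z *m z' = 0.
Proof.
move=> [[[Bz zz az] Cz] _ minz] [[[Bz' zz' az'] Cz'] _ minz'] neq.
have zC : z *m z' = z' *m z by apply: Cz.
have zzP : central_projections B (z *m z').
  split; first split.
  - exact: star_subalgebraM.
  - exact: idem_mulmx.
  - by rewrite adj_mxM az az' zC.
  - by move=> x Bx; rewrite -mulmxA Cz'// mulmxA Cz// mulmxA.
have [|->//|zE] := minz _ zzP; first by rewrite mulmxA zz.
have [|->//|z'E] := minz' _ zzP; first by rewrite zC mulmxA zz'.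
by case: neq; rewrite -zE z'E.
Qed.

Let ideal_projections (I : set 'M[K]_n) s := projections B s /\ I s.

(* A projection of maximal rank in a two-sided ideal is a unit for it. *)
Lemma ideal_unit (I : set 'M[K]_n) :
  I 0 -> (forall x y, I x -> I y -> I (x + y)) ->
  (forall x y, B x -> I y -> I (x *m y)) ->
  (forall x y, B x -> I y -> I (y *m x)) -> I `<=` B ->
  exists s, [/\ central_projections B s, I s & forall y, I y -> s *m y = y].
Proof.
move=> I0 ID Il Ir IB.
have ex_rank : exists r, `[< exists2 s, ideal_projections I s & \rank s = r >].
  exists (\rank (0 : 'M[K]_n)); apply/asboolP; exists 0 => //; split => //.
  by split; rewrite ?mulmx0 ?adj_mx0//; apply: star_subalgebra0.
have ub_rank r : `[< exists2 s, ideal_projections I s & \rank s = r >] -> (r <= n)%N.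
  by move=> /asboolP[s _ <-]; apply: rank_leq_row.
case: (ex_maxnP ex_rank ub_rank) => r /asboolP[s [sP Is] sr] maxr.
have [Bs ss as_] := sP.
have [Bt tt at_] := projections_compl subB sP.
have sI y : I y -> s *m y = y.
  (* If [k] were not 0, the support of [k k^*] would be a nonzero projection of the ideal orthogonal
     to [s], and adding it to [s] would raise the rank. *)
  move=> Iy; have [k kE] : exists k, k = (1%:M - s) *m y by eexists.
  have Ik : I k by rewrite kE; apply: Il.
  have sk : s *m k = 0 by rewrite kE mulmxA mulmxBr mulmx1 ss subrr mul0mx.
  have [||x [Bx [Be ee ae] ek]] := support_projection (h := k *m adj_mx k) subB.
  - by apply: (star_subalgebraM subB); [|apply: (star_subalgebra_adj subB)]; apply: IB.
  - by rewrite adj_mxM adj_mxK.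
  move: Be ee ae ek; set e := k *m adj_mx k *m x => Be ee ae ek.
  have se : s *m e = 0 by rewrite /e !mulmxA sk !mul0mx.
  have es : e *m s = 0 by rewrite -ae -as_ -adj_mxM se adj_mx0.
  have Ie : I e.
    by do 2!apply: (Ir) => //; apply: (star_subalgebra_adj subB); apply: IB.
  have seP : ideal_projections I (s + e).
    split; last exact: ID.
    split; first exact: star_subalgebraD.
    - by rewrite mulmxDl !mulmxDr ss ee se es addr0 add0r.
    - by rewrite adj_mxD as_ ae.
  have le_s : (s <= (s + e)%R)%MS.
    by apply/submxP; exists s; rewrite mulmxDr ss se addr0.
  have : ((s + e)%R <= s)%MS.
    have := mxrank_leqif_sup le_s; case=> le_r <-; rewrite eqn_leq le_r sr/=.
    by apply: maxr; apply/asboolP; exists (s + e).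
  move=> /submxP[D DE].
  have e0 : e = 0.
    have : (s + e) *m e = e by rewrite mulmxDl se ee add0r.
    by rewrite DE -mulmxA se mulmx0.
  have k0 : k = 0 by apply: mulmx_adj_eq0; rewrite -ek e0 mul0mx.
  by apply/esym/eqP; rewrite -subr_eq0 -[X in X - _]mul1mx -mulmxBl -kE k0.
(* A left unit for the ideal gives [s x s = x s]; the same for [x^*], after taking adjoints, gives
   [s x s = s x]. *)
exists s; split => //; split => // x Bx.
have xs : s *m (x *m s) = x *m s by apply/sI/Il.
have : adj_mx (s *m (adj_mx x *m s)) = adj_mx (adj_mx x *m s).
  by congr adj_mx; apply/sI/Il => //; apply: star_subalgebra_adj.
by rewrite !adj_mxM adj_mxK as_ -mulmxA xs => ->.
Qed.

(* Otherwise the unit of the ideal {y | p B y = 0} would be a central projection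
   separating p from p'. *)
Lemma min_projection_connected z p p' :
  min_central_projection B z -> min_projection B p -> min_projection B p' ->
  z *m p = p -> z *m p' = p' -> exists2 x, B x & p *m x *m p' <> 0.
Proof.
move=> [[[Bz zz az] Cz] _ minz] [[Bp pp ap] p0 _] [[Bp' pp' ap'] p'0 _] zp zp'.
apply: contrapT => noconn.
have pxp x : B x -> p *m x *m p' = 0.
  by move=> Bx; apply: contrapT => pxp0; apply: noconn; exists x.
pose I := [set y | B y /\ forall x, B x -> p *m x *m y = 0].
have [|||||s [[[Bs ss as_] Cs] [_ Is] sI]] := ideal_unit (I := I).
- by split=> [|x _]; rewrite ?mulmx0//; apply: star_subalgebra0.
- move=> x y [Bx Ix] [By Iy]; split; first exact: star_subalgebraD.
  by move=> u Bu; rewrite mulmxDr Ix// Iy// addr0.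
- move=> x y Bx [By Iy]; split; first exact: star_subalgebraM.
  by move=> u Bu; rewrite mulmxA -[p *m u *m x]mulmxA Iy//; apply: star_subalgebraM.
- move=> x y Bx [By Iy]; split; first exact: star_subalgebraM.
  by move=> u Bu; rewrite mulmxA Iy// mul0mx.
- by move=> x [].
have sp' : s *m p' = p' by apply: sI; split.
have zsP : central_projections B (z *m s).
  split; first split.
  - exact: star_subalgebraM.
  - by apply: idem_mulmx => //; apply: Cz.
  - by rewrite adj_mxM az as_ Cs.
  - by move=> x Bx; rewrite -mulmxA Cs// mulmxA Cz// mulmxA.
have [|zs0|zsE] := minz _ zsP; first by rewrite mulmxA zz.
- by apply: p'0; rewrite -zp' -sp' mulmxA zs0 mul0mx.
- apply: p0; rewrite -zp -zsE Cz// -mulmxA zp.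
  have := Is _ (star_subalgebra1 subB); rewrite mulmx1 => ps0.
  by rewrite -ap -as_ -adj_mxM ps0 adj_mx0.
Qed.

(** A nonzero [y = p x p'] exists by connectedness. Minimality makes both corners scalar, so
    [y y^* = c p] and [y^* y = c' p']; associativity of [y y^* y] forces [c = c'], and [w] is [y]
    divided by the square root of [c]. *)
Lemma min_projection_equiv z p p' :
  min_central_projection B z -> min_projection B p -> min_projection B p' ->
  z *m p = p -> z *m p' = p' ->
  exists w, [/\ B w, w *m adj_mx w = p & adj_mx w *m w = p'].
Proof.
move=> zP pP p'P zp zp'.
have [x Bx y0] := min_projection_connected zP pP p'P zp zp'.
have [[Bp pp ap] p0 _] := pP; have [[Bp' pp' ap'] p'0 _] := p'P.
set y := p *m x *m p' in y0.
have By : B y by do 2!apply: star_subalgebraM => //.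
have [|c yyE] := min_projection_corner (x := x *m p' *m adj_mx x) pP.
  by rewrite -mulmxA; do 2!apply: star_subalgebraM => //; apply: star_subalgebra_adj.
have [|c' yyE'] := min_projection_corner (x := adj_mx x *m p *m x) p'P.
  by do 2!apply: star_subalgebraM => //; apply: star_subalgebra_adj.
have {}yyE : y *m adj_mx y = c *: p.
  by rewrite -yyE /y !adj_mxM ap ap' !mulmxA -[_ *m p' *m p']mulmxA pp'.
have {}yyE' : adj_mx y *m y = c' *: p'.
  by rewrite -yyE' /y !adj_mxM ap ap' !mulmxA -[_ *m p *m p]mulmxA pp.
have trp := mxtrace_proj_gt0 pp ap p0.
have c0 : 0 < c.
  rewrite lt_def; apply/andP; split.
    by apply/eqP => c0; apply/y0/mulmx_adj_eq0; rewrite yyE c0 scale0r.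
  by have := mxtrace_mulmx_adj_ge0 y; rewrite yyE mxtraceZ pmulr_lge0.
have cc : c = c'.
  have : y *m adj_mx y *m y = y *m (adj_mx y *m y) by rewrite mulmxA.
  rewrite yyE yyE' -scalemxAl -scalemxAr /y !mulmxA pp -[_ *m p' *m p']mulmxA pp'.
  move=> /eqP; rewrite -subr_eq0 -scalerBl scaler_eq0 subr_eq0.
  by case/orP => /eqP // y00; rewrite /y y00 in y0.
exists ((sqrtC c)^-1 *: y); split; first exact: star_subalgebraZ.
- rewrite adj_mxZ -scalemxAl -scalemxAr scalerA yyE scalerA.
  rewrite conj_Creal ?rpredV ?ger0_real ?sqrtC_ge0 ?ltW//.
  by rewrite -invfM -expr2 sqrtCK mulVf ?scale1r// gt_eqF.
- rewrite adj_mxZ -scalemxAl -scalemxAr scalerA yyE' scalerA -cc.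
  rewrite conj_Creal ?rpredV ?ger0_real ?sqrtC_ge0 ?ltW//.
  by rewrite -invfM -expr2 sqrtCK mulVf ?scale1r// gt_eqF.
Qed.

Lemma min_projection_mxtrace z p p' :
  min_central_projection B z -> min_projection B p -> min_projection B p' ->
  z *m p = p -> z *m p' = p' -> \tr p = \tr p'.
Proof.
move=> zP pP p'P zp zp'.
have [w [_ <- <-]] := min_projection_equiv zP pP p'P zp zp'.
exact: mxtrace_mulC.
Qed.

End MinimalProjections.

Section MinimalTrace.
Context {K : numClosedFieldType} {n : nat} {B : set 'M[K]_n}.
Hypothesis subB : star_subalgebra B.

Lemma min_projection_exists z :
  min_central_projection B z -> exists2 p, min_projection B p & z *m p = p.
Proof.
move=> [[zP _] z0 _].
(* A nonzero projection of least rank under [z] is minimal. *)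
pose under_z p := [/\ projections B p, p <> 0 & z *m p = p].
have ex_rank : exists r, `[< exists2 p, under_z p & \rank p = r >].
  exists (\rank z); apply/asboolP; exists z => //; split => //.
  by case: zP.
case: (ex_minnP ex_rank) => r /asboolP[p [[Bp pp ap] p0 zp] pr] minr.
exists p => //; split => // q [Bq qq aq] pq.
have [q0|q0] := pselect (q = 0); [by left | right].
have qp : q *m p = q by rewrite -aq -ap -adj_mxM pq.
have le_q : (q <= p)%MS by apply/submxP; exists q.
have : (p <= q)%MS.
  have [le_r <-] := mxrank_leqif_sup le_q; rewrite eqn_leq le_r/= pr.
  apply: minr; apply/asboolP; exists q => //; split => //.
  by rewrite -pq mulmxA zp.
by move=> /submxP[D DE]; rewrite -pq {1}DE -mulmxA qq -DE.
Qed.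

(** By [min_projection_mxtrace] the choice of [p] is immaterial, and a minimal central [z] never
    meets the default 0. *)
Definition min_trace (z : 'M[K]_n) : K :=
  xget 0 [set t | exists p, [/\ min_projection B p, z *m p = p & t = \tr p]].

Lemma min_traceE z p :
  min_central_projection B z -> min_projection B p -> z *m p = p ->
  min_trace z = \tr p.
Proof.
move=> zP pP zp; rewrite /min_trace; case: xgetP => [_ _ [p' [p'P zp' ->]]|].
  exact: (min_projection_mxtrace subB zP).
by move/(_ (\tr p)); case; exists p.
Qed.

Lemma min_trace_gt0 z : min_central_projection B z -> 0 < min_trace z.
Proof.
move=> zP; have [p pP zp] := min_projection_exists zP.
rewrite (min_traceE zP pP zp); case: pP => [[_ pp ap] p0 _].
exact: mxtrace_proj_gt0.
Qed.

End MinimalTrace.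
Arguments min_trace {K n} B z.

(** * Intertwiners *)

Section ScalarMatrices.
Context {K : numClosedFieldType} {A : cstarAlgType K}.

Lemma star0 : star (0 : A) = 0.
Proof. by rewrite -[X in star X](scale0r 0) starZ conjC0 scale0r. Qed.

Lemma star1 : star (1 : A) = 1.
Proof. by rewrite -[LHS]mulr1 -[X in _ * X]starK -starM mulr1 starK. Qed.

Lemma star_alg (c : K) : star (c%:A : A) = (Num.conj c)%:A.
Proof. by rewrite starZ star1. Qed.

Lemma star_sum (I : Type) (r : seq I) (P : pred I) (F : I -> A) :
  star (\sum_(i <- r | P i) F i) = \sum_(i <- r | P i) star (F i).
Proof. by apply: (big_morph (@star K A)); [apply: starD | apply: star0]. Qed.

Lemma scal_mxM m n p (S : 'M[K]_(m, n)) (T : 'M[K]_(n, p)) :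
  scal_mx A (S *m T) = scal_mx A S *m scal_mx A T.
Proof. exact: (map_mxM (in_alg A)). Qed.

Lemma scal_mx1 n : scal_mx A (1%:M : 'M[K]_n) = 1%:M.
Proof. exact: (map_mx1 (in_alg A)). Qed.

Lemma scal_mx_lin m n c (S T : 'M[K]_(m, n)) :
  scal_mx A (c *: S + T) = c%:A *: scal_mx A S + scal_mx A T.
Proof. by rewrite -(map_mxZ (in_alg A)) -(map_mxD (in_alg A)). Qed.

Lemma scal_mx_inj m n : injective (@scal_mx K A m n).
Proof.
move=> S T /matrixP ST; apply/matrixP => i j.
by have := ST i j; rewrite !mxE => /(fmorph_inj (in_alg A)).
Qed.

Lemma star_mxM m n p (x : 'M[A]_(m, n)) (y : 'M[A]_(n, p)) :
  star_mx (x *m y) = star_mx y *m star_mx x.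
Proof.
apply/matrixP => i j; rewrite !mxE star_sum.
by apply: eq_bigr => k _; rewrite !mxE starM.
Qed.

Lemma star_scal_mx m n (T : 'M[K]_(m, n)) :
  star_mx (scal_mx A T) = scal_mx A (adj_mx T).
Proof. by apply/matrixP => i j; rewrite !mxE star_alg. Qed.

Lemma big_tens_index (V : nmodType) m n (F : 'I_(m * n) -> V) :
  \sum_i F i = \sum_i \sum_j F (mxtens_index (i, j)).
Proof.
rewrite pair_big (reindex (@mxtens_index m n)) /=; last first.
  by exists (@mxtens_unindex m n) => i _; rewrite (mxtens_indexK, mxtens_unindexK).
by apply: eq_bigr => -[].
Qed.

Lemma mulr_algC (c : K) (x : A) : x * c%:A = c%:A * x.
Proof. by rewrite mulr_algl mulr_algr. Qed.

(** The entries do not commute, so each double sum is taken in the order that collapses the inner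
    pair first: [w w^*] between [v] and [v^*], then [v^* v] between [w^*] and [w]. *)
Lemma unitary_mx_tens m n (v : 'M[A]_m) (w : 'M[A]_n) :
  unitary_mx v -> unitary_mx w -> unitary_mx (v *t w).
Proof.
move=> [vv' v'v] [ww' w'w]; split; apply/matrixP => i j.
- case: i / (mxtens_indexP i) => a b; case: j / (mxtens_indexP j) => c d.
  rewrite mxE (@big_tens_index _ m n).
  transitivity (\sum_k v a k * (w *m star_mx w) b d * star_mx v k c).
    apply: eq_bigr => k _; rewrite !mxE mulr_sumr mulr_suml.
    by apply: eq_bigr => l _; rewrite !mxE !mxtens_indexK/= starM !mulrA.
  under eq_bigr do rewrite ww' mxE mulr_natr mulrnAl.
  rewrite sumrMnl.
  transitivity ((v *m star_mx v) a c *+ (b == d)); first by rewrite mxE.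
  rewrite vv' !mxE -mulrnA mulnb; congr (_ *+ nat_of_bool _).
  by rewrite (can_eq (@mxtens_indexK m n)).
- case: i / (mxtens_indexP i) => a b; case: j / (mxtens_indexP j) => c d.
  rewrite mxE (@big_tens_index _ m n) exchange_big/=.
  transitivity (\sum_k star_mx w b k * (star_mx v *m v) a c * w k d).
    apply: eq_bigr => k _; rewrite !mxE mulr_sumr mulr_suml.
    by apply: eq_bigr => l _; rewrite !mxE !mxtens_indexK/= starM !mulrA.
  have v'vE : (star_mx v *m v) a c = (a == c)%:R by rewrite v'v mxE.
  under eq_bigr do rewrite v'vE mulr_natr mulrnAl.
  rewrite sumrMnl.
  transitivity ((star_mx w *m w) b d *+ (a == c)); first by rewrite mxE.
  rewrite w'w !mxE -mulrnA mulnb andbC; congr (_ *+ nat_of_bool _).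
  by rewrite (can_eq (@mxtens_indexK m n)).
Qed.

End ScalarMatrices.

Section Intertwiners.
Context {R : realType} {A : cstarAlgType R[i]}.

Lemma corep_hom_comp n p q (w : 'M[A]_n) (w' : 'M[A]_p) (w'' : 'M[A]_q) x y :
  corep_hom w' w'' x -> corep_hom w w' y -> corep_hom w w'' (x *m y).
Proof.
rewrite /corep_hom /= => xw yw.
by rewrite scal_mxM -mulmxA yw mulmxA xw -mulmxA.
Qed.

Lemma corep_hom_adj n p (w : 'M[A]_n) (w' : 'M[A]_p) x :
  unitary_mx w -> unitary_mx w' -> corep_hom w w' x -> corep_hom w' w (adj_mx x).
Proof.
move=> [ww' _] [_ w'w]; rewrite /corep_hom /= -star_scal_mx => xw.
have := congr1 (@star_mx _ _ _ _) xw; rewrite !star_mxM => xw'.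
rewrite -[LHS]mul1mx -ww' -mulmxA [star_mx w *m _]mulmxA xw'.
by rewrite -!mulmxA w'w mulmx1.
Qed.

Lemma star_subalgebra_corep_hom n (w : 'M[A]_n) :
  unitary_mx w -> star_subalgebra (corep_hom w w).
Proof.
move=> uw; split; [ | | exact: corep_hom_comp | by move=> x; apply: corep_hom_adj].
- by rewrite /corep_hom /= scal_mx1 mul1mx mulmx1.
- rewrite /corep_hom /= => c x y xw yw.
  rewrite scal_mx_lin mulmxDl mulmxDr yw -scalemxAl xw.
  congr (_ + _); apply/matrixP => i j; rewrite !mxE mulr_sumr.
  by apply: eq_bigr => k _; rewrite !mxE -!scalerAl !mul1r !scalerAr.
Qed.

Lemma corep_hom_tens1 n m (w : 'M[A]_n) (L : 'M[A]_m) x :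
  corep_hom w w x -> corep_hom (w *t L) (w *t L) (x *t 1%:M).
Proof.
rewrite /corep_hom /= => /matrixP xw; apply/matrixP => i j.
case: i / (mxtens_indexP i) => a b; case: j / (mxtens_indexP j) => c d.
have {xw} := congr1 (fun y => y * L b d) (xw a c).
rewrite !mxE !(@big_tens_index _ n m) !mulr_suml => xw.
transitivity (\sum_i scal_mx A x a i * w i c * L b d).
  apply: eq_bigr => k _; rewrite (bigD1 b)//= big1 => [|l /negbTE lb].
    by rewrite !mxE !mxtens_indexK /= ?mxE eqxx mulr1 addr0 mulrA.
  by rewrite !mxE !mxtens_indexK/= ?mxE eq_sym lb mulr0 scale0r mul0r.
rewrite xw; apply: eq_bigr => k _.
rewrite (bigD1 d)//= big1 => [|l /negbTE ld].
  by rewrite !mxE !mxtens_indexK /= ?mxE eqxx mulr1 addr0 -!mulrA mulr_algC.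
by rewrite !mxE !mxtens_indexK/= ?mxE ld mulr0 scale0r mulr0.
Qed.

End Intertwiners.

(** * Orthogonal families of projections *)

Section ProjectionFamilies.
Context {K : numClosedFieldType}.

Lemma mxtrace_tens1 n m (x : 'M[K]_n) : \tr (x *t (1%:M : 'M[K]_m)) = (\tr x) * m%:R.
Proof.
rewrite /mxtrace big_tens_index mulr_suml; apply: eq_bigr => i _.
rewrite (eq_bigr (fun=> x i i)) => [|j _].
  by rewrite sumr_const card_ord mulr_natr.
by rewrite !mxE !mxtens_indexK/= ?mxE eqxx mulr1.
Qed.

Lemma tens1_mxM n m (x y : 'M[K]_n) :
  (x *t (1%:M : 'M[K]_m)) *m (y *t 1%:M) = (x *m y) *t 1%:M.
Proof. by rewrite tensmx_mul mulmx1. Qed.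

Lemma adj_tens1_mx n m (x : 'M[K]_n) :
  adj_mx (x *t (1%:M : 'M[K]_m)) = adj_mx x *t 1%:M.
Proof. by rewrite adj_mx_tens adj_mx1. Qed.

(** By orthogonality the idempotent [y c] fixes each of its summands [g t], hence so does each of
    the commuting factors. This places the projections that witness a multiplicity under both
    vertices. *)
Lemma orth_sum_absorb n k (g : 'I_k -> 'M[K]_n) (y c : 'M[K]_n) :
  (forall t, g t *m g t = g t) ->
  (forall t t', t != t' -> g t *m g t' = 0) ->
  y *m c = \sum_t g t -> c *m y = y *m c -> c *m c = c -> y *m y = y ->
  forall t, c *m g t = g t /\ y *m g t = g t.
Proof.
move=> gg go ycE cy cc yy t.
have gE : y *m c *m g t = g t.
  rewrite ycE mulmx_suml (bigD1 t)//= gg big1 ?addr0// => s st.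
  exact: go.
split; last by rewrite -[in LHS]gE !mulmxA yy gE.
by rewrite -[in LHS]gE -cy !mulmxA cc cy gE.
Qed.

(** With [s] the sum of the [c i], the matrix [e - e s - d] is a projection, so its trace is
    nonnegative. In the application [e] is [p (x) 1], the [c i] are the upper neighbours and [d]
    gathers the lower ones. *)
Lemma mxtrace_proj_family n l (P : pred 'I_l) (e d : 'M[K]_n) (c : 'I_l -> 'M[K]_n) :
  e *m e = e -> adj_mx e = e -> d *m d = d -> adj_mx d = d -> e *m d = d ->
  (forall i, P i -> [/\ c i *m c i = c i, adj_mx (c i) = c i,
                        e *m c i = c i *m e & c i *m d = 0]) ->
  (forall i j, P i -> P j -> i != j -> c i *m c j = 0) ->
  \sum_(i | P i) \tr (e *m c i) + \tr d <= \tr e.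
Proof.
move=> ee ae dd ad ed cP co.
have [s sE] : exists s, s = \sum_(i | P i) c i by eexists.
have ss : s *m s = s.
  rewrite sE mulmx_suml; apply: eq_bigr => i Pi.
  rewrite mulmx_sumr (bigD1 i)//= big1 ?addr0; first by case: (cP i Pi).
  by move=> j /andP[Pj ji]; apply: co => //; rewrite eq_sym.
have as_ : adj_mx s = s.
  rewrite sE (big_morph (@adj_mx K n n) (@adj_mxD _ _ _) (@adj_mx0 _ _ _)).
  by apply: eq_bigr => i Pi; case: (cP i Pi).
have es : e *m s = s *m e.
  rewrite sE mulmx_suml mulmx_sumr; apply: eq_bigr => i Pi.
  by case: (cP i Pi).
have sd : s *m d = 0.
  by rewrite sE mulmx_suml big1// => i Pi; case: (cP i Pi).
have [q qE] : exists q, q = e - e *m s by eexists.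
have qq : q *m q = q.
  rewrite qE mulmxBl !mulmxBr mulmxA ee (idem_mulmx ee ss es) -mulmxA -es mulmxA ee.
  by rewrite subrr subr0.
have aq : adj_mx q = q by rewrite qE adj_mxB adj_mxM ae as_ es.
have qd : q *m d = d by rewrite qE mulmxBl -mulmxA sd mulmx0 subr0.
have dq : d *m q = d by rewrite -ad -aq -adj_mxM qd.
have : 0 <= \tr (q - d).
  apply: mxtrace_proj_ge0; last by rewrite adj_mxB aq ad.
  by rewrite mulmxBl !mulmxBr qq qd dq dd subrr subr0.
rewrite qE !linearB/= -raddf_sum -mulmx_sumr -sE => h.
by rewrite -subr_ge0 opprD addrA.
Qed.

(** The [V u] are partial isometries with initial projections [q u] and orthogonal ranges; [d] is
    the projection on the sum of these ranges. *)
Lemma mxtrace_isometry_family n n' (U : finType) (V : U -> 'M[K]_(n', n))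
    (q : U -> 'M[K]_n) :
  (forall u u', u != u' -> adj_mx (V u) *m V u' = 0) ->
  (forall u, adj_mx (V u) *m V u = q u) -> (forall u, V u *m q u = V u) ->
  let d := \sum_u V u *m adj_mx (V u) in
  [/\ d *m d = d, adj_mx d = d & \tr d = \sum_u \tr (q u)].
Proof.
move=> Vo VV Vq d; split.
- rewrite /d mulmx_suml; apply: eq_bigr => u _.
  rewrite mulmx_sumr (bigD1 u)//= big1 ?addr0 => [|u' u'u].
    by rewrite mulmxA -[_ *m adj_mx _ *m _]mulmxA VV Vq.
  by rewrite mulmxA -[_ *m adj_mx _ *m _]mulmxA Vo 1?eq_sym// mulmx0 mul0mx.
- by rewrite adj_mx_sum; apply: eq_bigr => u _; rewrite adj_mxM adj_mxK.
- by rewrite raddf_sum; apply: eq_bigr => u _ /=; rewrite mxtrace_mulC VV.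
Qed.

End ProjectionFamilies.

Section UpwardEdges.
Context {K : numClosedFieldType} {n m : nat}.
Variables (B : set 'M[K]_n) (B' : set 'M[K]_(n * m)).
Hypotheses (subB : star_subalgebra B) (subB' : star_subalgebra B').
Hypothesis BB' : forall x, B x -> B' (x *t 1%:M).

Lemma mxtrace_upward z c p p0 k (g : 'I_k -> 'M[K]_(n * m)) :
  min_central_projection B z -> min_central_projection B' c ->
  min_projection B p -> z *m p = p -> min_projection B p0 -> z *m p0 = p0 ->
  (forall t, min_projection B' (g t)) ->
  (forall t t', t != t' -> g t *m g t' = 0) ->
  (p0 *t 1%:M) *m c = \sum_t g t ->
  k%:R * min_trace B' c = \tr ((p *t 1%:M) *m c).
Proof.
move=> zP cP pP zp p0P zp0 gP go p0c.
have [w [Bw ww w'w]] := min_projection_equiv subB zP pP p0P zp zp0.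
have [[[Bc cc ac] Cc] _ _] := cP; have [[Bp0 pp0 _] _ _] := p0P.
have -> : \tr ((p *t 1%:M) *m c) = \tr ((p0 *t 1%:M) *m c).
  rewrite -ww -w'w -[in LHS]tens1_mxM -mulmxA mxtrace_mulC -mulmxA Cc; last exact: BB'.
  by rewrite mulmxA tens1_mxM.
have cg t : c *m g t = g t.
  apply: (orth_sum_absorb _ go p0c _ cc _ t).1 => //.
  - by move=> s; case: (gP s) => [[]].
  - by apply: Cc; apply: BB'.
  - by rewrite tens1_mxM pp0.
rewrite p0c raddf_sum (eq_bigr (fun=> min_trace B' c)) => [|t _].
  by rewrite sumr_const card_ord mulr_natl.
by rewrite (min_traceE subB' cP (gP t)).
Qed.

End UpwardEdges.

Section Cup.
Context {R : realType} {A : cstarAlgType R[i]}.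
Context {n m : nat}.
Variables (w : 'M[A]_n) (L L' : 'M[A]_m) (G : 'M[R[i]]_m).

(* The operator xi |-> xi (x) sum_(a,b) G_ab e_a (x) e_b. *)
Definition cup : 'M[R[i]]_(n * m * m, n) :=
  \matrix_(i, k) (((mxtens_unindex (mxtens_unindex i).1).1 == k)%:R *
    G (mxtens_unindex (mxtens_unindex i).1).2 (mxtens_unindex i).2).

Lemma cupE k a b l :
  cup (mxtens_index (mxtens_index (k, a), b)) l = (k == l)%:R * G a b.
Proof. by rewrite mxE !mxtens_indexK. Qed.

(** The hypothesis says that the vector with coefficients [G] is fixed by [L *t L']. *)
Lemma corep_hom_cup :
  L *m scal_mx A G *m L'^T = scal_mx A G ->
  corep_hom w (w *t L *t L') cup.
Proof.
move=> LGL; rewrite /corep_hom /=; apply/matrixP => i l.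
case: i / (mxtens_indexP i) => ka b; case: ka / (mxtens_indexP ka) => k a.
transitivity (w k l * scal_mx A G a b).
  rewrite mxE (bigD1 k)//= big1 => [|k' /negbTE k'k].
    by rewrite !mxE !mxtens_indexK/= eqxx mul1r addr0 mulr_algC.
  by rewrite !mxE !mxtens_indexK/= eq_sym k'k mul0r scale0r mul0r.
rewrite [RHS]mxE !big_tens_index (bigD1 l)//= [X in _ = _ + X]big1 => [|l' /negbTE l'l].
  rewrite addr0 -LGL [X in _ * X]mxE mulr_sumr exchange_big/=; apply: eq_bigr => d _.
  rewrite !mxE mulr_suml mulr_sumr; apply: eq_bigr => c _.
  rewrite !mxE !mxtens_indexK/= eqxx mul1r -!mulrA; congr (_ * (_ * _)).
  by rewrite mulr_algC.
rewrite big1 // => c _; rewrite big1 // => d _.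
by rewrite !mxE !mxtens_indexK/= l'l mul0r scale0r mulr0.
Qed.

(** Compressing [y (x) 1] by the cup slices the second leg of [y] with the functional
    [Tr (G G^* .)]. *)
Lemma mxtrace_cup (F : 'M[R[i]]_n) (y : 'M[R[i]]_(n * m)) :
  \tr (F *m (adj_mx cup *m (y *t 1%:M) *m cup)) =
  \tr ((F *t (G *m adj_mx G)) *m y).
Proof.
have ycE ia b l : ((y *t 1%:M) *m cup) (mxtens_index (ia, b)) l =
    \sum_a y ia (mxtens_index (l, a)) * G a b.
  rewrite mxE !big_tens_index (bigD1 l)//= [X in _ + X]big1 => [|l' /negbTE l'l].
    rewrite addr0; apply: eq_bigr => a _; rewrite (bigD1 b)//= big1 => [|b' /negbTE b'b].
      by rewrite cupE tensmxE mxE !eqxx mulr1 mul1r addr0.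
    by rewrite tensmxE mxE eq_sym b'b mulr0 mul0r.
  by rewrite big1 // => a _; rewrite big1 // => b' _; rewrite cupE l'l mul0r mulr0.
have cycE k l : (adj_mx cup *m (y *t 1%:M) *m cup) k l =
    \sum_a \sum_b Num.conj (G a b) *
      \sum_a' y (mxtens_index (k, a)) (mxtens_index (l, a')) * G a' b.
  rewrite -mulmxA mxE !big_tens_index (bigD1 k)//= [X in _ + X]big1 => [|k' /negbTE k'k].
    rewrite addr0; apply: eq_bigr => a _; apply: eq_bigr => b _.
    by rewrite ycE [in LHS]mxE [in LHS]mxE cupE eqxx mul1r.
  rewrite big1 // => a _; rewrite big1 // => b _.
  by rewrite [in LHS]mxE [in LHS]mxE cupE k'k mul0r conjC0 mul0r.
rewrite /mxtrace big_tens_index; apply: eq_bigr => i _.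
rewrite mxE (eq_bigr _ (fun j _ => congr1 _ (cycE j i))).
under [RHS]eq_bigr do rewrite mxE big_tens_index.
rewrite exchange_big/=; apply: eq_bigr => k _.
rewrite mulr_sumr (eq_bigr (fun a => \sum_a' \sum_b F i k * (G a' b * Num.conj (G a b)) *
  y (mxtens_index (k, a)) (mxtens_index (i, a')))) => [|a _].
  rewrite exchange_big/=; apply: eq_bigr => a' _; apply: eq_bigr => a _.
  rewrite tensmxE mxE mulr_sumr mulr_suml.
  by apply: eq_bigr => b _; rewrite !mxE.
rewrite exchange_big/= mulr_sumr; apply: eq_bigr => b _.
rewrite !mulr_sumr; apply: eq_bigr => a' _.
by rewrite -!mulrA; congr (_ * _); rewrite [RHS]mulrC -mulrA; congr (_ * _); rewrite mulrC.
Qed.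

End Cup.

Lemma conform_mx_cast (V : Type) m n m' n' (e : (m = m') * (n = n'))
    (x : 'M[V]_(m', n')) (y : 'M[V]_(m, n)) :
  conform_mx x y = castmx e y.
Proof. by rewrite -(conform_castmx e) conform_mx_id. Qed.

(** * Edges of the Bratteli diagram *)

Section WordInclusions.
Context {R : realType}.

Lemma word_dim_diag m i : word_dim m i i = 1%N.
Proof. by case: i => //= i; rewrite ltnn. Qed.

Lemma word_dim_succ m i : word_dim m i i.+1 = m.
Proof. by rewrite /= leqnn word_dim_diag mul1n. Qed.

Lemma word_dim_succ2 m i : word_dim m i i.+2 = (m * m)%N.
Proof. by rewrite /= leqW// leqnn word_dim_diag mul1n. Qed.

Lemma word_incl_succ m j (x : 'M[R[i]]_(word_dim m 0 j)) :
  word_incl 0 j.+1 x = x *t (1%:M : 'M[R[i]]_m).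
Proof.
change (conform_mx (0 : 'M[R[i]]_(word_dim m 0 j * m))
  ((1%:M : 'M[R[i]]_1) *t x *t (1%:M : 'M[R[i]]_(word_dim m j j.+1))) = x *t 1%:M).
move: (word_dim m 0 j) x (word_dim m j j.+1) (word_dim_succ m j) => n x _ ->.
have e : (1 * n * m = n * m)%N by rewrite mul1n.
rewrite (conform_mx_cast (e, e)); apply/matrixP => i i'.
have castE k a : cast_ord (esym e) (mxtens_index (k, a)) =
    mxtens_index (mxtens_index (ord0, k), a) by apply: val_inj.
case: i / (mxtens_indexP i) => k a; case: i' / (mxtens_indexP i') => k' a'.
by rewrite castmxE /= !castE !tensmxE [1%:M ord0 ord0]mxE eqxx mul1r.
Qed.

(** Tensoring the fixed vector on the left by the identity gives the cup. Hence annihilating the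
    Jones projection will amount to annihilating the cup. *)
Lemma word_incl_jonesE (A : cstarAlgType R[i]) (f : R[i] -> A -> R[i]) m (v : 'M[A]_m) n :
  let G := qmat f (letter f v n.+1) in
  let r := fixed_vector f (letter f v n.+1) in
  let r' : 'M[R[i]]_(word_dim m 0 n * m * m, word_dim m 0 n) := cup G in
  word_incl 0 n.+2 (word_jones f v n) =
  ((adj_mx r *m r) 0 0)^-1 *: (r' *m adj_mx r').
Proof.
move=> G r; rewrite /word_jones -/r; set c := (_ 0 0)^-1.
have rE a b : r (mxtens_index (a, b)) 0 = G a b by rewrite mxE mxtens_indexK.
move: (r) rE (c) => {}r rE {}c.
have adjE a b : adj_mx r 0 (mxtens_index (a, b)) = Num.conj (G a b).
  by rewrite mxE [LHS]mxE rE.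
change (conform_mx (0 : 'M[R[i]]_(word_dim m 0 n * m * m))
  ((1%:M : 'M[R[i]]_(word_dim m 0 n)) *t
   conform_mx (0 : 'M[R[i]]_(word_dim m n n.+2)) (c *: (r *m adj_mx r)) *t
   (1%:M : 'M[R[i]]_(word_dim m n.+2 n.+2))) =
  c *: ((cup G : 'M[R[i]]_(word_dim m 0 n * m * m, _)) *m adj_mx (cup G))).
move: (G) rE adjE => {}G rE adjE.
move: (word_dim m n n.+2) (word_dim_succ2 m n) => _ ->.
move: (word_dim m n.+2 n.+2) (word_dim_diag m n.+2) => _ ->.
move: (word_dim m 0 n) => N; rewrite conform_mx_id.
have e : (N * (m * m) * 1 = N * m * m)%N by rewrite muln1 mulnA.
rewrite (conform_mx_cast (e, e)); apply/matrixP => i i'.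
have castE k a b : cast_ord (esym e) (mxtens_index (mxtens_index (k, a), b)) =
    mxtens_index (mxtens_index (k, mxtens_index (a, b)), ord0).
  by apply: val_inj; rewrite /= muln1 addn0 mulnDl mulnA addnA.
case: i / (mxtens_indexP i) => ka b; case: ka / (mxtens_indexP ka) => k a.
case: i' / (mxtens_indexP i') => ka' b'; case: ka' / (mxtens_indexP ka') => k' a'.
rewrite castmxE /= !castE !tensmxE [1%:M ord0 ord0]mxE eqxx mulr1.
rewrite [1%:M k k']mxE [in LHS]mxE [in LHS]mxE big_ord1 adjE rE.
rewrite [RHS]mxE [X in _ = _ * X]mxE (bigD1 k)//= big1 ?addr0 => [|l /negbTE lk]; last first.
  by rewrite cupE eq_sym lk !mul0r.
have -> : adj_mx (cup G : 'M[R[i]]_(N * m * m, N)) k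
    (mxtens_index (mxtens_index (k', a'), b')) = 
    (k' == k)%:R * Num.conj (G a' b').
  by rewrite mxE [LHS]mxE cupE rmorphM /= conjC_nat.
rewrite cupE eqxx mul1r [k == k']eq_sym.
by rewrite mulrCA; congr (_ * _); rewrite mulrCA.
Qed.

End WordInclusions.

(** * Edges to the level below, by Frobenius reciprocity *)

Section DownwardEdges.
Context {R : realType}.
Let C := R[i].
Context {n m : nat} (G : 'M[C]_m) (B : set 'M[C]_n) (B' : set 'M[C]_(n * m)).
Hypotheses (subB : star_subalgebra B) (subB' : star_subalgebra B').
Hypothesis BB' : forall x, B x -> B' (x *t 1%:M).
Let r : 'M[C]_(n * m * m, n) := cup G.
Hypothesis rBr : forall y, B' y -> B (adj_mx r *m (y *t 1%:M) *m r).
(** Stands for the square of [Q] at one level; [F'] is then its square at the next level. *)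
Variable F : 'M[C]_n.
Let F' : 'M[C]_(n * m) := F *t (G *m adj_mx G).
Hypothesis F'C : forall y, B' y -> F' *m y = y *m F'.
Hypothesis F_faithful : forall q, projections B q -> q <> 0 -> \tr (F *m q) <> 0.
Hypothesis F'_faithful :
  forall q, projections B' q -> q <> 0 -> \tr (F' *m q) <> 0.

Lemma cup_mulmx (q : 'M[C]_n) :
  (cup G : 'M[R[i]]_(n * m * m, n)) *m q = (q *t 1%:M *t 1%:M) *m cup G.
Proof.
apply/matrixP => i l.
case: i / (mxtens_indexP i) => ka b; case: ka / (mxtens_indexP ka) => k a.
transitivity (q k l * G a b).
  rewrite mxE (bigD1 k)//= big1 => [|k' /negbTE k'k].
    by rewrite cupE eqxx mul1r addr0 mulrC.
  by rewrite cupE eq_sym k'k !mul0r.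
rewrite mxE !big_tens_index (bigD1 l)//= [X in _ = _ + X]big1 => [|l' /negbTE l'l].
  rewrite addr0 (bigD1 a)//= [X in _ = _ + X]big1 => [|a' /negbTE a'a].
    rewrite addr0 (bigD1 b)//= [X in _ = _ + X]big1 => [|b' /negbTE b'b].
      by rewrite cupE !tensmxE !mxE !eqxx !mulr1 mul1r addr0.
    by rewrite tensmxE [1%:M b b']mxE eq_sym b'b mulr0 mul0r.
  rewrite big1 // => b' _.
  by rewrite !tensmxE [1%:M a a']mxE eq_sym a'a mulr0 !mul0r.
by rewrite big1 // => a' _; rewrite big1 // => b' _; rewrite cupE l'l mul0r mulr0.
Qed.

(* By Frobenius reciprocity, composing with r turns a copy of a in b (x) L into
   a copy of b in a (x) L'; the functional tr (F' .), being a trace on B',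
   shows that orthogonal copies give orthogonal ranges. *)
Lemma downward_isometries a b p q k (g : 'I_k -> 'M[C]_(n * m)) :
  min_central_projection B b -> min_central_projection B' a ->
  min_projection B' p -> a *m p = p -> min_projection B q -> b *m q = q ->
  (forall t, min_projection B' (g t)) ->
  (forall t t', t != t' -> g t *m g t' = 0) ->
  (q *t 1%:M) *m a = \sum_t g t ->
  exists y : 'I_k -> 'M[C]_(n * m), let V s := (y s *t 1%:M) *m r in
  [/\ forall s, B' (y s), forall s, adj_mx (V s) *m V s = q,
      forall s, V s *m q = V s, forall s, (p *t 1%:M) *m V s = V s
    & forall s s', s != s' -> adj_mx (V s) *m V s' = 0].
Proof.
move=> bP aP pP ap qP bq gP go qaE.
have [[[Ba aa aa_] Ca] _ _] := aP; have [[Bq qq aq] q0 _] := qP.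
have [[Bp pp ap_] p0 _] := pP.
have gg t : g t *m g t = g t by case: (gP t) => [[]].
have ag t : adj_mx (g t) = g t by case: (gP t) => [[]].
have absorb := orth_sum_absorb gg go qaE.
have {absorb} absorb t : a *m g t = g t /\ (q *t 1%:M) *m g t = g t.
  by apply: absorb => //; [apply/Ca/BB' | rewrite tens1_mxM qq].
have gq t : g t *m (q *t 1%:M) = g t.
  have [_ /(congr1 (@adj_mx _ _ _))] := absorb t.
  by rewrite adj_mxM adj_tens1_mx aq ag.
have /choice[w wP] t := min_projection_equiv subB' aP pP (gP t) ap (absorb t).1.
have Bw t : B' (w t) by case: (wP t).
have Baw t : B' (adj_mx (w t)) by apply: star_subalgebra_adj.
have ww t : w t *m adj_mx (w t) = p by case: (wP t).
have w'w t : adj_mx (w t) *m w t = g t by case: (wP t).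
have wg t : w t *m g t = w t.
  apply/eqP; rewrite -subr_eq0 -[X in _ - X]mulmx1 -mulmxBr; apply/eqP/adj_mulmx_eq0.
  by rewrite adj_mxM -mulmxA [adj_mx (w t) *m _]mulmxA w'w mulmxBr gg mulmx1 subrr mulmx0.
have pw t : p *m w t = w t by rewrite -(ww t) -mulmxA w'w wg.
have [S SE] : exists S, forall t, S t = (w t *t 1%:M) *m r by eexists.
have Sq t : S t *m q = S t.
  by rewrite SE -mulmxA cup_mulmx mulmxA tens1_mxM -{1}wg -mulmxA gq wg.
have pS t : (p *t 1%:M) *m S t = S t by rewrite SE mulmxA tens1_mxM pw.
have SSE s t : adj_mx (S s) *m S t =
    adj_mx r *m ((adj_mx (w s) *m w t) *t 1%:M) *m r.
  by rewrite !SE adj_mxM adj_tens1_mx -tens1_mxM !mulmxA.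
(* [mxtrace_cup] moves the trace to [B'], where [F'] commutes with everything, so the two factors
   can be exchanged. The product [w t (w s)^*] vanishes for [s != t], since it contains
   [g t *m g s]. *)
have trSS s t : \tr (F *m (adj_mx (S s) *m S t)) = \tr (F' *m (w t *m adj_mx (w s))).
  rewrite SSE mxtrace_cup -/F' mulmxA (F'C (Baw s)) -mulmxA mxtrace_mulC.
  by rewrite -mulmxA.
(* These products lie in the corner [q B q], which is scalar because [q] is minimal; the traces
   above then decide whether [l s t] vanishes. *)
have [l lE] : exists l, forall s t, adj_mx (S s) *m S t = l s t *: q.
  have /choice[l lE] (st : 'I_k * 'I_k) :
      exists c, adj_mx (S st.1) *m S st.2 = c *: q.
    have [|c cE] := min_projection_corner (x := adj_mx (S st.1) *m S st.2) subB qP.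
      by rewrite SSE; apply/rBr/star_subalgebraM.
    by exists c; rewrite -cE -!mulmxA Sq mulmxA -{1}aq -adj_mxM Sq.
  by exists (fun s t => l (s, t)) => s t; rewrite -lE.
have l0 s t : s != t -> l s t = 0.
  move=> st; have := trSS s t; rewrite lE -scalemxAr mxtraceZ.
  rewrite -(wg t) -(wg s) adj_mxM ag mulmxA -[_ *m g t *m g s]mulmxA.
  rewrite go 1?eq_sym// mulmx0 mul0mx mulmx0 mxtrace0 => /eqP.
  by rewrite mulf_eq0 => /orP[/eqP//|/eqP/F_faithful]; case.
have l_gt0 s : 0 < l s s.
  have trq : 0 < \tr q by apply: mxtrace_proj_gt0.
  rewrite lt_def; apply/andP; split; last first.
    have := mxtrace_mulmx_adj_ge0 (adj_mx (S s)).
    by rewrite adj_mxK lE mxtraceZ pmulr_lge0.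
  apply/eqP => ls0; have := trSS s s.
  rewrite lE ls0 scale0r mulmx0 mxtrace0 ww => /esym.
  exact: F'_faithful.
pose c s := (sqrtC (l s s))^-1.
have cc s : Num.conj (c s) = c s.
  by rewrite conj_Creal// rpredV ger0_real// sqrtC_ge0 ltW.
have VE s : ((c s *: w s) *t 1%:M) *m r = c s *: S s.
  rewrite SE [RHS]scalemxAl; congr (_ *m _).
  by apply/matrixP => i j; rewrite !mxE mulrA.
exists (fun s => c s *: w s); split => [s|s|s|s|s s' ss'].
- exact: star_subalgebraZ.
- rewrite VE adj_mxZ -scalemxAl -scalemxAr scalerA lE scalerA cc.
  by rewrite -invfM -expr2 sqrtCK mulVf ?scale1r// gt_eqF.
- by rewrite VE -scalemxAl Sq.
- by rewrite VE -scalemxAr pS.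
- by rewrite !VE adj_mxZ -scalemxAl -scalemxAr lE l0// scale0r !scaler0.
Qed.

End DownwardEdges.

(** * Norm of the principal graph *)

(** Each term is split by the inequality between geometric and arithmetic means, weighted by the
    ratio of [d' j] to [d i]; the row sums bound one half and the column sums the other. *)
Lemma schur_test (F : realFieldType) k l (M : 'I_k -> 'I_l -> F)
    (x d : 'I_k -> F) (y d' : 'I_l -> F) (c : F) :
  0 <= c -> (forall i j, 0 <= M i j) -> (forall i, 0 < d i) -> (forall j, 0 < d' j) ->
  (forall i, \sum_j M i j * d' j <= c * d i) ->
  (forall j, \sum_i M i j * d i <= c * d' j) ->
  \sum_i x i ^+ 2 <= 1 -> \sum_j y j ^+ 2 <= 1 ->
  \sum_i \sum_j x i * M i j * y j <= c.
Proof.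
move=> c0 M0 d0 d'0 rowM colM x1 y1.
have term i j : x i * M i j * y j <=
    2^-1 * (x i ^+ 2 / d i * (M i j * d' j)) + 2^-1 * (y j ^+ 2 / d' j * (M i j * d i)).
  have [di dj] := (lt0r_neq0 (d0 i), lt0r_neq0 (d'0 j)).
  have sq : 0 <= M i j * ((x i * d' j - y j * d i) ^+ 2 / (d i * d' j)) / 2.
    rewrite divr_ge0// mulr_ge0// divr_ge0 ?sqr_ge0//.
    by rewrite mulr_ge0// ltW.
  rewrite -subr_ge0; apply: le_trans sq _; rewrite le_eqVlt; apply/orP; left.
  apply/eqP; field.
  by rewrite di dj.
apply: (le_trans (ler_sum _ (fun i _ => ler_sum _ (fun j _ => term i j)))).
under eq_bigr do rewrite big_split /= -!mulr_sumr.
rewrite big_split /= -!mulr_sumr [X in _ + _ * X]exchange_big /=.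
have half a b : a <= c -> b <= c -> 2^-1 * a + 2^-1 * b <= c :> F.
  by move=> ac bc; lra.
apply: half.
- apply: (@le_trans _ _ (\sum_i x i ^+ 2 * c)).
    apply: ler_sum => i _; rewrite -mulrA ler_wpM2l ?sqr_ge0//.
    by rewrite ler_pdivrMl// mulrC; have := rowM i; rewrite mulrC.
  by rewrite -mulr_suml ler_piMl.
- apply: (@le_trans _ _ (\sum_i y i ^+ 2 * c)).
    apply: ler_sum => j _; rewrite -mulr_sumr -mulrA ler_wpM2l ?sqr_ge0//.
    by rewrite ler_pdivrMl// mulrC; have := colM j; rewrite mulrC.
  by rewrite -mulr_suml ler_piMl.
Qed.

Section BratteliMultiplicity.
Context {R : realType} (P : lambda_system R).

Lemma bratteli_mult_eq0 (a b : bratteli_vertex P) :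
  tag b != (tag a).+1 -> bratteli_mult a b = 0%N.
Proof. by rewrite /bratteli_mult => /negbTE ->. Qed.

(** The value 0 is also the default taken when nothing witnesses a multiplicity, hence the first
    alternative. *)
Lemma bratteli_multP j (a : 'M[R[i]]_(hdim P 0 j)) (b : 'M[R[i]]_(hdim P 0 j.+1)) :
  let k := bratteli_mult (existT _ j a : bratteli_vertex P) (existT _ j.+1 b) in
  k = 0%N \/ exists p (g : 'I_k -> 'M[R[i]]_(hdim P 0 j.+1)),
    [/\ min_projection (alg P 0 j) p /\ a *m p = p,
        forall t, min_projection (alg P 0 j.+1) (g t),
        forall t t', t != t' -> g t *m g t' = 0
      & incl P 0 j.+1 p *m b = \sum_t g t].
Proof.
rewrite /bratteli_mult /= eqxx; case: xgetP => [k _ wit|_]; last by left.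
by right.
Qed.

(** Transports the projection of [t] to the size of level [n]; meaningful when [tag t = n]. *)
Definition vertex_at n (t : bratteli_vertex P) : 'M[R[i]]_(hdim P 0 n) :=
  conform_mx 0 (tagged t).

Lemma vertex_atE n (t : bratteli_vertex P) :
  tag t = n -> t = existT _ n (vertex_at n t).
Proof. by case: t => k z /= <-; rewrite /vertex_at conform_mx_id. Qed.

End BratteliMultiplicity.

(** * Weights of the neighbours of a principal vertex *)

Section PrincipalGraphNorm.
Context {R : realType} {A : cstarAlgType R[i]}.
Variables (f : R[i] -> A -> R[i]) (m : nat) (v : 'M[A]_m).
Let P := popa_system f v.
Let N j := word_dim m 0 j.
Let w j : 'M[A]_(N j) := word_corep f v 0 j.
Let L := letter f v.
Let B j : set 'M[R[i]]_(N j) := corep_hom (w j) (w j).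
Arguments B : clear implicits.
Let Q j : 'M[R[i]]_(N j) := qmat f (w j).

Hypothesis L_unitary : forall p, unitary_mx (L p).
Hypothesis L_fixed : forall p,
  L p *m scal_mx A (qmat f (L p)) *m (L p.+1)^T = scal_mx A (qmat f (L p)).
Hypothesis Q_comm : forall j (x : 'M[R[i]]_(N j)), B j x -> Q j *m x = x *m Q j.
Hypothesis Q_adj : forall j, adj_mx (Q j) = Q j.
Hypothesis Q_unit : forall j, Q j \in unitmx.
Hypothesis Q_succ : forall j, Q j.+1 = Q j *t qmat f (L j.+1).
Hypothesis QL_adj : forall p, adj_mx (qmat f (L p)) = qmat f (L p).

Lemma word_corep_unitary j : unitary_mx (w j).
Proof.
elim: j => [|j IHj]; last exact: (unitary_mx_tens IHj).
have s1 : star_mx (1%:M : 'M[A]_1) = 1%:M.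
  by apply/matrixP => i k; rewrite !ord1 !mxE star1.
by rewrite /w /=; split; rewrite s1 mulmx1.
Qed.

Let subB j : star_subalgebra (B j).
Proof. exact/star_subalgebra_corep_hom/word_corep_unitary. Qed.

Let BB j (x : 'M[R[i]]_(N j)) : B j x -> B j.+1 (x *t 1%:M).
Proof. exact: corep_hom_tens1. Qed.

Let r j : 'M[R[i]]_(N j.+2, N j) := cup (qmat f (L j.+1)).

Let rBr j (y : 'M[R[i]]_(N j.+1)) : B j.+1 y -> B j (adj_mx (r j) *m (y *t 1%:M) *m r j).
Proof.
move=> By; have rw : corep_hom (w j) (w j.+2) (r j) by apply/corep_hom_cup/L_fixed.
apply: (corep_hom_comp _ rw); apply: (corep_hom_comp _ (BB By)).
by apply: (corep_hom_adj _ _ rw); apply: word_corep_unitary.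
Qed.

Let trQ_faithful j (q : 'M[R[i]]_(N j)) :
  projections (B j) q -> q <> 0 -> \tr (Q j *m Q j *m q) <> 0.
Proof.
move=> [_ qq aq] q0 tr0; apply: q0.
have Qq0 : Q j *m q = 0.
  apply: mxtrace_mulmx_adj_eq0; rewrite adj_mxM Q_adj aq mulmxA -[_ *m q *m q]mulmxA qq.
  by rewrite mxtrace_mulC mulmxA.
by rewrite -[q]mul1mx -(mulVmx (Q_unit j)) -mulmxA Qq0 mulmx0.
Qed.

Let vtrace (t : bratteli_vertex P) := min_trace (alg P 0 (tag t)) (tagged t).

Let trF' j : Q j *m Q j *t (qmat f (L j.+1) *m adj_mx (qmat f (L j.+1))) =
  Q j.+1 *m Q j.+1.
Proof. by rewrite QL_adj -tensmx_mul -Q_succ. Qed.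

(** The Jones projection is a multiple of [r r^*], and [c r r^* = 0] forces [c r = 0]. This keeps
    upper neighbours orthogonal to the copies of lower ones, which factor through [r]. *)
Lemma principal_mulmx_cup j (c : 'M[R[i]]_(N j.+2)) :
  principal_vertex (existT _ j.+2 c : bratteli_vertex P) -> c *m r j = 0.
Proof.
move=> [_ /(_ j erefl)] /=; rewrite word_incl_jonesE.
(* If the fixed vector is 0, its inverse squared norm is 0 by convention and the Jones projection
   carries no information, but then [r] itself is 0. *)
set l := _ 0 0; have [l0 _|l0] := eqVneq l 0.
  have fv0 : fixed_vector f (L j.+1) = 0.
    apply: adj_mulmx_eq0; apply/matrixP => i k; rewrite !ord1 [RHS]mxE.
    exact: l0.
  suff -> : r j = 0 by rewrite mulmx0.
  apply/matrixP => i k.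
  case: i / (mxtens_indexP i) => ia b; case: ia / (mxtens_indexP ia) => l' a.
  rewrite cupE mxE.
  have := congr1 (fun x : 'cV[R[i]]_(m * m) => x (mxtens_index (a, b)) 0) fv0.
  by rewrite !mxE mxtens_indexK /= => ->; rewrite mulr0.
rewrite -scalemxAr => /eqP; rewrite scaler_eq0 invr_eq0 (negbTE l0)/= => /eqP crr.
by apply: mulmx_adj_eq0; rewrite adj_mxM mulmxA -[c *m _ *m _]mulmxA crr mul0mx.
Qed.

(** [d] projects on the sum of all the copies, under [p (x) 1], of the vertices [s i] one level
    lower, each taken with its multiplicity. *)
Lemma downward_projection j (a p : 'M[R[i]]_(N j.+1)) l
    (s : 'I_l -> bratteli_vertex P) :
  min_central_projection (B j.+1) a -> min_projection (B j.+1) p -> a *m p = p ->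
  injective s -> (forall i, principal_vertex (s i)) ->
  exists d : 'M[R[i]]_(N j.+2),
    [/\ d *m d = d, adj_mx d = d, (p *t 1%:M) *m d = d,
        forall c, principal_vertex (existT _ j.+2 c : bratteli_vertex P) ->
          c *m d = 0
      & \sum_i (bratteli_mult (s i) (existT _ j.+1 a))%:R * vtrace (s i) = \tr d].
Proof.
move=> aP pP ap s_inj sP.
pose k i := bratteli_mult (s i) (existT _ j.+1 a : bratteli_vertex P).
pose b i : 'M[R[i]]_(N j) := vertex_at j (s i).
pose V y : 'M[R[i]]_(N j.+2, N j) := (y *t 1%:M) *m r j.
(* The family is indexed by [nat] rather than ['I_(k i)], so that its type does not depend on [i]
   and [choice] applies. Vertices at other levels have [k i = 0] and get dummy values. *)
have wit i : exists qy : 'M[R[i]]_(N j) * (nat -> 'M[R[i]]_(N j.+1)),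
    forall t : 'I_(k i),
    [/\ [/\ tag (s i) = j, min_central_projection (B j) (b i),
            b i *m qy.1 = qy.1, adj_mx qy.1 = qy.1 & vtrace (s i) = \tr qy.1],
        [/\ B j.+1 (qy.2 t), adj_mx (V (qy.2 t)) *m V (qy.2 t) = qy.1,
            V (qy.2 t) *m qy.1 = V (qy.2 t) & (p *t 1%:M) *m V (qy.2 t) = V (qy.2 t)]
      & forall t' : 'I_(k i), t != t' -> adj_mx (V (qy.2 t)) *m V (qy.2 t') = 0].
  have [tagi|tagi] := eqVneq (tag (s i)) j; last first.
    exists (0, fun=> 0) => -[t]; rewrite /k bratteli_mult_eq0// /=.
    by rewrite eqSS eq_sym.
  have siE := vertex_atE tagi.
  have bP : min_central_projection (B j) (b i) by have := sP i; rewrite siE => -[].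
  have := bratteli_multP (P := P) (b i) a; rewrite -siE -/(k i).
  move=> [k0|[q [g [[qP bq] gP go]]]].
    by exists (0, fun=> 0) => -[t]; rewrite k0.
  rewrite /= word_incl_succ => qaE.
  have vtr : vtrace (s i) = \tr q.
    by rewrite siE /vtrace /=; apply: (min_traceE (subB j) bP qP bq).
  have [||y [By VV Vq pV Vo]] := downward_isometries (subB j) (subB j.+1)
    (@BB j) (@rBr j) (F := Q j *m Q j) _ (@trQ_faithful j) _ bP aP pP ap qP bq gP go qaE.
  - by move=> x Bx; rewrite trF' -mulmxA (Q_comm Bx) mulmxA (Q_comm Bx) mulmxA.
  - by move=> q'; rewrite trF'; apply: trQ_faithful.
  exists (q, fun t => oapp y 0 (insub t)) => t /=; rewrite valK /=.
  case: (qP) => -[_ _ aq] _ _; split; [by split| |].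
    by split; [apply: By|apply: VV|apply: Vq|apply: pV].
  by move=> t' tt'; rewrite valK /=; apply: Vo.
have {wit} /choice[qy qyP] := wit.
pose U := {i : 'I_l & 'I_(k i)}.
pose q (u : U) := (qy (tag u)).1.
pose y (u : U) := (qy (tag u)).2 (tagged u).
have [Vu VuE] : exists Vu : U -> 'M[R[i]]_(N j.+2, N j),
  forall u, Vu u = V (y u) by eexists.
have VV u : adj_mx (Vu u) *m Vu u = q u.
  by rewrite VuE; case: (qyP _ (tagged u)) => _ [].
have Vq u : Vu u *m q u = Vu u.
  by rewrite VuE; case: (qyP _ (tagged u)) => _ [].
have pV u : (p *t 1%:M) *m Vu u = Vu u.
  by rewrite VuE; case: (qyP _ (tagged u)) => _ [].
have By u : B j.+1 (y u) by case: (qyP _ (tagged u)) => _ [].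
have Vo u u' : u != u' -> adj_mx (Vu u) *m Vu u' = 0.
  case: u u' => [i t] [i' t']; have [ii'|ii' _] := eqVneq i i'.
    case: _ / ii' t' => t' tt'; rewrite !VuE.
    have [_ _] := qyP _ t; apply; apply: contra tt' => /eqP ->.
    exact: eqxx.
  have [[tagi bP bq aq _] _ _] := qyP _ t.
  have [[tagi' bP' bq' _ _] _ _] := qyP _ t'.
  (* Copies of distinct vertices: the product is an element of [B j] between [b i] and [b i'], which
     are central and orthogonal. *)
  have BT : B j (adj_mx (Vu (existT _ i t)) *m Vu (existT _ i' t')).
    rewrite !VuE /V adj_mxM adj_tens1_mx mulmxA -[_ *m _ *m (_ *t _)]mulmxA tens1_mxM.
    apply/rBr/(star_subalgebraM (subB _)); last exact: (By (existT _ i' t')).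
    exact: (star_subalgebra_adj (subB _) (By (existT _ i t))).
  have [[_ Cb'] _ _] := bP'.
  rewrite -(Vq (existT _ i t)) -(Vq (existT _ i' t')) adj_mxM /q /= aq.
  rewrite mulmxA -[_ *m _ *m Vu _]mulmxA.
  move: (_ *m Vu _) BT => T BT.
  have qb : (qy i).1 *m b i = (qy i).1.
    by case: bP => [[[_ _ ab] _] _ _]; rewrite -aq -{1}ab -adj_mxM bq.
  rewrite -bq' mulmxA -[_ *m T *m _]mulmxA -Cb'// mulmxA -qb -[_ *m b i *m b i']mulmxA.
  rewrite (min_central_projection_orth (subB j) bP bP') ?mulmx0 ?mul0mx// => bb.
  by case/eqP: ii'; apply: s_inj; rewrite (vertex_atE tagi) (vertex_atE tagi') -/(b i) bb.
have [dd ad trd] := mxtrace_isometry_family Vo VV Vq.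
exists (\sum_u Vu u *m adj_mx (Vu u)); split => //.
- by rewrite mulmx_sumr; apply: eq_bigr => u _; rewrite mulmxA pV.
- move=> c cP; rewrite mulmx_sumr big1// => u _.
  suff cV : c *m Vu u = 0 by rewrite mulmxA cV mul0mx.
  have [[[_ Cc] _ _] _] := cP.
  rewrite VuE /V mulmxA Cc; last exact: (BB (By u)).
  by rewrite -mulmxA principal_mulmx_cup// mulmx0.
- have -> : \tr (\sum_u Vu u *m adj_mx (Vu u)) = \sum_i \sum_(t < k i) \tr (qy i).1.
    by rewrite trd [RHS]sig_big_dep.
  apply: eq_bigr => i _; rewrite -/(k i).
  case: (k i) (qyP i) => [|k']; first by rewrite mul0r big_ord0.
  move=> /(_ ord0)[[_ _ _ _ ->] _ _].
  by rewrite sumr_const card_ord mulr_natl.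
Qed.

(** At level 0 there is no lower level and [d = 0] serves. *)
Lemma mxtrace_downward j (a p : 'M[R[i]]_(N j)) l
    (s : 'I_l -> bratteli_vertex P) :
  min_central_projection (B j) a -> min_projection (B j) p -> a *m p = p ->
  injective s -> (forall i, principal_vertex (s i)) ->
  exists d : 'M[R[i]]_(N j.+1),
    [/\ d *m d = d, adj_mx d = d, (p *t 1%:M) *m d = d,
        forall c, principal_vertex (existT _ j.+1 c : bratteli_vertex P) ->
          c *m d = 0
      & \sum_i (bratteli_mult (s i) (existT _ j a))%:R * vtrace (s i) = \tr d].
Proof.
case: j a p => [|j] a p; last exact: downward_projection.
move=> *; exists 0; split; rewrite ?mulmx0 ?adj_mx0 ?mxtrace0//.
  by move=> c _; rewrite mulmx0.
by rewrite big1// => i _; rewrite bratteli_mult_eq0 ?mul0r.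
Qed.

Lemma neighbour_vtrace_le a l (s : 'I_l -> bratteli_vertex P) :
  principal_vertex a -> injective s -> (forall i, principal_vertex (s i)) ->
  \sum_i (bratteli_mult a (s i) + bratteli_mult (s i) a)%:R * vtrace (s i) <=
    m%:R * vtrace a.
Proof.
case: a => j a [aP _] s_inj sP; rewrite /= in aP.
have [p pP ap] := min_projection_exists aP.
have [d [dd ad pd cd trd]] := mxtrace_downward aP pP ap s_inj sP.
under eq_bigr do rewrite natrD mulrDl.
rewrite big_split /= trd.
pose c i : 'M[R[i]]_(N j.+1) := vertex_at j.+1 (s i).
pose up i := tag (s i) == j.+1.
have cP i : up i -> principal_vertex (existT _ j.+1 (c i) : bratteli_vertex P).
  by move=> /eqP/vertex_atE siE; rewrite -siE.
have [[Bp pp ap_] p0 _] := pP.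
have [[[Ba aa aa_] Ca] _ _] := aP.
have vE : m%:R * vtrace (existT _ j a) = \tr (p *t (1%:M : 'M[R[i]]_m)).
  by rewrite /vtrace /= (min_traceE (subB j) aP pP ap) mxtrace_tens1 mulrC.
rewrite vE.
apply: le_trans (mxtrace_proj_family (P := up) (c := c) _ _ dd ad pd _ _).
- rewrite lerD2r (bigID up)/= [X in _ + X]big1 ?addr0 => [|i nup]; last first.
    by rewrite bratteli_mult_eq0 ?mul0r.
  apply: ler_sum => i upi; have [cPi _] := cP i upi.
  have siE := vertex_atE (eqP upi).
  have := bratteli_multP (P := P) a (c i); rewrite -siE /=.
  (* A multiplicity 0 may be a default value; it is enough then that the right-hand side is the
     trace of a projection. *)
  move=> [->|[p' [g [[p'P ap'] gP go p'c]]]].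
    rewrite mul0r; have [[[Bc cc ac] Cc] _ _] := cPi.
    have pc : (p *t 1%:M) *m c i = c i *m (p *t 1%:M) by rewrite Cc//; apply: BB.
    apply: mxtrace_proj_ge0.
      by apply: idem_mulmx => //; rewrite tens1_mxM pp.
    by rewrite adj_mxM ac adj_tens1_mx ap_ pc.
  rewrite /= word_incl_succ in p'c.
  have := mxtrace_upward (subB j) (subB j.+1) (@BB j) aP cPi pP ap p'P ap' gP go p'c.
  by move=> <-; rewrite siE /vtrace.
- by rewrite tens1_mxM pp.
- by rewrite adj_tens1_mx ap_.
- move=> i upi; have [[[[Bc cc ac] Cc] _ _] _] := cP i upi; split=> //.
    by rewrite Cc//; apply: BB.
  by apply: cd; apply: cP.
- move=> i i' upi upi' ii'; have [cPi _] := cP i upi; have [cPi' _] := cP i' upi'.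
  apply: (min_central_projection_orth (subB j.+1)) => // ccE.
  case/eqP: ii'; apply: s_inj.
  by rewrite (vertex_atE (eqP upi)) (vertex_atE (eqP upi')) -/(c i) ccE.
Qed.

Lemma graph_norm_principal_le :
  (graph_norm R (principal_graph P) <= (m%:R : R)%:E)%E.
Proof.
apply: ge_ereal_sup => _ [_ [k [l [s [t [x [y [s_inj t_inj x1 y1 ->]]]]]]] <-].
rewrite lee_fin.
(* The weights are positive in [R[i]], hence real; Schur's test is applied to their real parts. *)
pose d a := complex.Re (vtrace a).
have dE a : principal_vertex a -> vtrace a = (d a)%:C /\ 0 < d a.
  move=> [aP _]; have := min_trace_gt0 (subB _) aP; rewrite -/(vtrace a) /d.
  by case: (vtrace a) => re im; rewrite ltcE /= => /andP[/eqP -> ->].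
have sval_inj (T : Type) (p : T -> Prop) : injective (sval : {z | p z} -> T).
  by move=> [a pa] [b pb] /= ab; subst b; congr exist; apply: Prop_irrelevance.
have le_d n (u : 'I_n -> bratteli_vertex P) a : principal_vertex a -> injective u ->
    (forall i, principal_vertex (u i)) ->
    \sum_i (bratteli_mult a (u i) + bratteli_mult (u i) a)%:R * d (u i) <= m%:R * d a.
  move=> aP u_inj uP; rewrite -lecR; have := neighbour_vtrace_le aP u_inj uP.
  rewrite (dE a aP).1 rmorphM rmorph_nat rmorph_sum.
  rewrite (eq_bigr (fun i =>
    ((bratteli_mult a (u i) + bratteli_mult (u i) a)%:R * d (u i))%:C)) //.
  by move=> i _; rewrite rmorphM rmorph_nat (dE _ (uP i)).1.
have sP i : principal_vertex (sval (s i)) by case: (svalP (s i)).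
have tP i : principal_vertex (sval (t i)) by case: (svalP (t i)).
apply: (schur_test (d := fun i => d (sval (s i))) (d' := fun j => d (sval (t j)))) => //.
- by move=> i; case: (dE _ (sP i)).
- by move=> j; case: (dE _ (tP j)).
- by move=> i; apply: le_d => //; apply: inj_comp t_inj; apply: sval_inj.
- move=> j; apply: le_trans (le_d _ (fun i => sval (s i)) _ (tP j) _ sP).
    by apply: ler_sum => i _; rewrite addnC.
  by apply: inj_comp s_inj; apply: sval_inj.
Qed.

End PrincipalGraphNorm.

(** * Comultiplication and antipode *)

Section Comultiplication.
Context {R : realType} (W : woronowicz_algebra R).
Let C := R[i].
Let A := walg W.

Lemma wcoef1 : wcoef (1 : A). Proof. exact: SpanOne. Qed.

Lemma wcoefD (a b : A) : wcoef a -> wcoef b -> wcoef (a + b).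
Proof. exact: SpanAdd. Qed.

Lemma wcoefZ (c : C) (a : A) : wcoef a -> wcoef (c *: a).
Proof. exact: SpanScale. Qed.

Lemma wcoefM (a b : A) : wcoef a -> wcoef b -> wcoef (a * b).
Proof. exact: SpanMul. Qed.

Lemma wcoef_star (a : A) : wcoef a -> wcoef (star a).
Proof. exact: SpanStar. Qed.

Lemma wcoef0 : wcoef (0 : A).
Proof. by rewrite -(scale0r 1); apply/wcoefZ/wcoef1. Qed.

Lemma wcoef_sum (I : eqType) (r : seq I) (F : I -> A) :
  (forall i, i \in r -> wcoef (F i)) -> wcoef (\sum_(i <- r) F i).
Proof.
move=> Fw; rewrite big_seq; elim/big_rec: _ => [|i x ir xw]; first exact: wcoef0.
exact: wcoefD (Fw i ir) xw.
Qed.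

(** The antipode and the characters are controlled on [A_s] only, so linearity is restricted to
    it. *)
Definition wcoef_linear (V : lmodType C) (phi : A -> V) : Prop :=
  forall c a b, wcoef a -> wcoef b -> phi (c *: a + b) = c *: phi a + phi b.

Section WcoefLinear.
Context {V : lmodType C} {phi : A -> V} (phi_lin : wcoef_linear phi).

Lemma wcoef_linear0 : phi 0 = 0.
Proof.
rewrite -[0 in LHS](addNr 1) -scaleN1r phi_lin; try exact: wcoef1.
by rewrite scaleN1r addNr.
Qed.

Lemma wcoef_linearD a b : wcoef a -> wcoef b -> phi (a + b) = phi a + phi b.
Proof. by move=> aw bw; rewrite -[a]scale1r phi_lin// !scale1r. Qed.

Lemma wcoef_linearZ c a : wcoef a -> phi (c *: a) = c *: phi a.
Proof.
move=> aw; rewrite -[_ *: _]addr0 phi_lin//; last exact: wcoef0.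
by rewrite wcoef_linear0 addr0.
Qed.

Lemma wcoef_linear_sum (I : eqType) (r : seq I) (F : I -> A) :
  (forall i, i \in r -> wcoef (F i)) ->
  phi (\sum_(i <- r) F i) = \sum_(i <- r) phi (F i).
Proof.
elim: r => [|i r IHr] Fw; first by rewrite !big_nil wcoef_linear0.
rewrite !big_cons wcoef_linearD; first rewrite IHr//.
- by move=> j jr; apply: Fw; rewrite inE jr orbT.
- by apply: Fw; rewrite inE eqxx.
- by apply: wcoef_sum => j jr; apply: Fw; rewrite inE jr orbT.
Qed.

End WcoefLinear.

Definition wcoef_bilinear (V : lmodType C) (phi : A -> A -> V) : Prop :=
  (forall b, wcoef b -> wcoef_linear (phi ^~ b)) /\
  (forall a, wcoef a -> wcoef_linear (phi a)).

Lemma bilinear_eliminate (V : lmodType C) (phi : A -> A -> V) n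
    (a b : 'I_n.+1 -> A) (e : 'I_n -> C) k0 :
  wcoef_bilinear phi -> (forall k, wcoef (a k)) -> (forall k, wcoef (b k)) ->
  a k0 = - \sum_j e j *: a (lift k0 j) ->
  \sum_k phi (a k) (b k) =
  \sum_j phi (a (lift k0 j)) (b (lift k0 j) - e j *: b k0).
Proof.
move=> [phil phir] aw bw ak0.
rewrite (bigD1_ord k0)//= ak0 -sumrN.
rewrite (wcoef_linear_sum (phil _ (bw k0))); last first.
  by move=> j _; rewrite -scaleNr; apply: wcoefZ.
rewrite -big_split/=; apply: eq_bigr => j _.
rewrite -scaleNr (wcoef_linearZ (phil _ (bw k0)))//.
rewrite -[- (e j *: b k0)]scaleNr [b _ + _]addrC.
by rewrite (phir _ (aw _)).
Qed.

Lemma winl_winr_bilinear :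
  wcoef_bilinear (fun a b : A => winl W a * winr W b).
Proof.
split=> a aw c b d bw dw /=; first by rewrite linearP mulrDl scalerAl.
by rewrite linearP mulrDr scalerAr.
Qed.

(* A relation among the first legs allows one term to be eliminated; once they
   are linearly independent, the second legs vanish. *)
Lemma tens_eq0_bilinear (V : lmodType C) (phi : A -> A -> V) n (a b : 'I_n -> A) :
  wcoef_bilinear phi -> (forall k, wcoef (a k)) -> (forall k, wcoef (b k)) ->
  \sum_k winl W (a k) * winr W (b k) = 0 -> \sum_k phi (a k) (b k) = 0.
Proof.
move=> phi_bil; elim: n a b => [|n IHn] a b aw bw ab0; first by rewrite big_ord0.
have [ind|] := pselect (forall c : 'I_n.+1 -> C,
    \sum_k c k *: a k = 0 -> forall k, c k = 0).
  have [[_ _ _ /(_ _ a b ind ab0) b0] _ _] := wtensorP W.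
  by rewrite big1// => k _; rewrite b0 (wcoef_linear0 (phi_bil.2 _ (aw k))).
move=> /existsNP[c /not_implyP[ca0 /existsNP[k0 ck0]]].
pose e j := c (lift k0 j) / c k0.
have ak0 : a k0 = - \sum_j e j *: a (lift k0 j).
  have {}ck0 : c k0 != 0 by apply/eqP.
  apply: (scalerI ck0); rewrite scalerN scaler_sumr.
  move/eqP: ca0; rewrite (bigD1_ord k0)//= addr_eq0 => /eqP ->; congr (- _).
  by apply: eq_bigr => j _; rewrite scalerA mulrC divfK.
rewrite (bilinear_eliminate phi_bil aw bw ak0); apply: IHn => // [k|].
  by rewrite -scaleNr addrC; apply: wcoefD => //; apply: wcoefZ.
by rewrite -(bilinear_eliminate winl_winr_bilinear aw bw ak0).
Qed.

Definition wcoef_legs (s : seq (A * A)) : Prop :=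
  forall x, x \in s -> wcoef x.1 /\ wcoef x.2.

(** Universal property of the algebraic tensor product: bilinear maps on [A_s] factor through its
    image in [wtensor W], so sums over an expansion do not depend on the expansion. *)
Lemma eq_tens_bilinear (V : lmodType C) (phi : A -> A -> V) s s' :
  wcoef_bilinear phi -> wcoef_legs s -> wcoef_legs s' ->
  tens (winl W) (winr W) s = tens (winl W) (winr W) s' ->
  \sum_(x <- s) phi x.1 x.2 = \sum_(x <- s') phi x.1 x.2.
Proof.
move=> phi_bil sw s'w ss'.
(* An expansion of the difference of the two tensors. *)
pose r := s ++ [seq (- x.1, x.2) | x <- s'].
have rw : wcoef_legs r.
  move=> x; rewrite mem_cat => /orP[/sw//|/mapP[y /s'w[y1 y2] ->]] /=.
  by split=> //; rewrite -scaleN1r; apply: wcoefZ.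
have sumr (U : lmodType C) (psi : A -> A -> U) : wcoef_bilinear psi ->
    \sum_(x <- r) psi x.1 x.2 =
    \sum_(x <- s) psi x.1 x.2 - \sum_(x <- s') psi x.1 x.2.
  move=> [psil _]; rewrite big_cat /= big_map -sumrN; congr (_ + _).
  rewrite 2!big_seq; apply: eq_bigr => x /s'w[x1 x2] /=.
  by rewrite -scaleN1r (wcoef_linearZ (psil _ x2))// scaleN1r.
apply/eqP; rewrite -subr_eq0 -sumr//; apply/eqP.
rewrite big_tnth; apply: tens_eq0_bilinear => // [k|k|].
- by case: (rw _ (mem_tnth k (in_tuple r))).
- by case: (rw _ (mem_tnth k (in_tuple r))).
have := sumr _ _ winl_winr_bilinear; rewrite big_tnth => ->.
by move: ss'; rewrite /tens => ->; rewrite subrr.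
Qed.

(** The existence of [s] ensures that [comult a] is a genuine expansion rather than the default. *)
Lemma sum_comult (V : lmodType C) (phi : A -> A -> V) a s :
  wcoef_bilinear phi -> wcoef_legs s -> wdelta W a = tens (winl W) (winr W) s ->
  \sum_(x <- comult a) phi x.1 x.2 = \sum_(x <- s) phi x.1 x.2.
Proof.
move=> phi_bil sw as_.
have [cw ac] : wcoef_legs (comult a) /\
    wdelta W a = tens (winl W) (winr W) (comult a).
  by apply: (@xgetPex _ [::] [set s : seq (A * A) | wcoef_legs s /\
    wdelta W a = tens (winl W) (winr W) s]); exists s.
by apply: eq_tens_bilinear => //; rewrite -ac.
Qed.

End Comultiplication.

Section Corepresentations.
Context {R : realType} (W : woronowicz_algebra R).
Let C := R[i].
Let A := walg W.

Lemma tens_map_corep m (v : 'M[A]_m) i j :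
  unitary_corep v ->
  wdelta W (v i j) = tens (winl W) (winr W) [seq (v i k, v k j) | k <- enum 'I_m].
Proof. by move=> [_ _ ->]; rewrite /tens big_map big_enum. Qed.

Lemma sum_comult_corep (V : lmodType C) (phi : A -> A -> V) m (v : 'M[A]_m) i j :
  unitary_corep v -> wcoef_bilinear phi ->
  \sum_(x <- comult (v i j)) phi x.1 x.2 = \sum_k phi (v i k) (v k j).
Proof.
move=> vP phi_bil; rewrite (sum_comult phi_bil _ (tens_map_corep i j vP)).
  by rewrite big_map big_enum.
by move=> x /mapP[k _ ->]; case: vP => vw _ _; split; apply: vw.
Qed.

(** Meant for the two-sided convolutions, where the inner one returns a combination of a column of
    [v]. *)
Lemma sum_comult_corep_lin (V : lmodType C) (phi : A -> A -> V) m (v : 'M[A]_m)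
    (c : 'I_m -> C) j :
  unitary_corep v -> wcoef_bilinear phi ->
  \sum_(x <- comult (\sum_k c k *: v k j)) phi x.1 x.2 =
  \sum_k c k *: \sum_l phi (v k l) (v l j).
Proof.
move=> vP phi_bil; have [vw _ vd] := vP.
pose s := [seq (c kl.1 *: v kl.1 kl.2, v kl.2 j) | kl <- enum {: 'I_m * 'I_m}].
have sw : wcoef_legs s.
  by move=> x /mapP[k _ ->]; split => /=; [apply: wcoefZ|]; apply: vw.
rewrite (sum_comult phi_bil sw).
  rewrite big_map big_enum /=.
  under [RHS]eq_bigr do rewrite scaler_sumr.
  rewrite [RHS]pair_bigA; apply: eq_bigr => kl _ /=.
  by rewrite (wcoef_linearZ (phi_bil.1 _ (vw _ _))).
rewrite linear_sum /tens big_map big_enum /=.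
rewrite -(pair_bigA _ (fun k l => winl W (c k *: v k l) * winr W (v l j))) /=.
apply: eq_bigr => k _; rewrite linearZ /= vd scaler_sumr.
by apply: eq_bigr => l _; rewrite linearZ /= scalerAl.
Qed.

End Corepresentations.

(** * Antipode identities on [A_s] and the inverse of the conjugate corepresentation *)

Section Antipode.
Context {R : realType} (W : woronowicz_algebra R).
Let C := R[i].
Let A := walg W.
Let kappa : A -> A := wkappa (w := W).

Lemma wkappa_wcoef_linear : wcoef_linear kappa.
Proof. by move=> c a b aw bw; apply: wkappa_linear. Qed.

(** Take [y] with [kappa y = 1] and apply antimultiplicativity to [y * 1]. *)
Lemma wkappa1 : kappa 1 = 1.
Proof.
have y1 : kappa (star (kappa (star 1))) = 1 by apply/wkappa_star/wcoef1.
have yw : wcoef (star (kappa (star 1))) by apply/wcoef_star/wkappa_coef/wcoef_star/wcoef1.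
have := wkappaM yw (wcoef1 W); rewrite mulr1 -/kappa y1 mulr1.
by move=> <-.
Qed.

Lemma wkappa_starV a : wcoef a -> star (kappa (star (kappa a))) = a.
Proof.
move=> aw; have := wkappa_star (wcoef_star aw); rewrite starK => h.
by rewrite /kappa h starK.
Qed.

Lemma wcoef_bilinear_kappal : wcoef_bilinear (fun a b : A => kappa a * b).
Proof.
split=> a aw c b d bw dw /=.
  by rewrite wkappa_wcoef_linear// mulrDl scalerAl.
by rewrite mulrDr scalerAr.
Qed.

Lemma wcoef_bilinear_kappar : wcoef_bilinear (fun a b : A => a * kappa b).
Proof.
split=> a aw c b d bw dw /=; first by rewrite mulrDl scalerAl.
by rewrite wkappa_wcoef_linear// mulrDr scalerAr.
Qed.

Lemma kappa_inj_scalar (t : A) c :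
  wcoef t -> kappa t = (Num.conj c)%:A -> star t = c%:A.
Proof.
move=> tw kt; rewrite -[in LHS](wkappa_starV tw) kt starK star_alg conjCK.
rewrite (wcoef_linearZ wkappa_wcoef_linear) ?wkappa1//; exact: wcoef1.
Qed.

(** To be instantiated by the counit [f 0]. *)
Variable e : A -> C.
Hypothesis e_lin : forall (c : C) a b,
  wcoef a -> wcoef b -> e (c *: a + b) = c * e a + e b.
Hypothesis eM : forall a b, wcoef a -> wcoef b -> e (a * b) = e a * e b.
Hypothesis e1 : e 1 = 1.
Hypothesis e_star : forall a, wcoef a -> e (star a) = Num.conj (e a).
Hypothesis e_u : map_mx e (wu W) = 1%:M.

Let e_linear : wcoef_linear (e : A -> C^o). Proof. exact: e_lin. Qed.

(* The star case needs both identities at once: applying kappa to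
   sum x2 kappa^-1(x1) gives sum x1 kappa(x2). *)
Lemma antipode_exists a : wcoef a ->
  exists s, [/\ wcoef_legs s, wdelta W a = tens (winl W) (winr W) s,
    \sum_(x <- s) kappa x.1 * x.2 = (e a)%:A
    & \sum_(x <- s) x.1 * kappa x.2 = (e a)%:A].
Proof.
elim=> {a} [_ [i [j ->]]||a b aw [s [sw as_ ks sk]] bw [s' [s'w bs' ks' sk']]
  |c a aw [s [sw as_ ks sk]]|a b aw [s [sw as_ ks sk]] bw [s' [s'w bs' ks' sk']]
  |a aw [s [sw as_ ks sk]]].
- have uw k l : wcoef (wu W k l) by apply: SpanGen; exists k, l.
  have ku k l : kappa (wu W k l) = star (wu W l k).
    by have := congr1 (fun x : 'M[A]__ => x k l) (wkappa_u W); rewrite !mxE.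
  have eij : e (wu W i j) = (i == j)%:R.
    by have := congr1 (fun x : 'M[C]__ => x i j) e_u; rewrite !mxE.
  have [uu' u'u] := wu_unitary W.
  exists [seq (wu W i k, wu W k j) | k <- enum 'I_(wdim W)]; split.
  + by move=> x /mapP[k _ ->]; split; apply: uw.
  + by rewrite /tens big_map big_enum wdeltaE.
  + rewrite big_map big_enum /= eij scaler_nat.
    have := congr1 (fun x : 'M[A]__ => x i j) u'u; rewrite !mxE => <-.
    by apply: eq_bigr => k _; rewrite !mxE ku.
  + rewrite big_map big_enum /= eij scaler_nat.
    have := congr1 (fun x : 'M[A]__ => x i j) uu'; rewrite !mxE => <-.
    by apply: eq_bigr => k _; rewrite !mxE ku.
- exists [:: (1, 1)]; split.
  + by move=> x; rewrite inE => /eqP -> /=; split; apply: wcoef1.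
  + by rewrite /tens big_seq1 !rmorph1 mulr1.
  + by rewrite big_seq1 wkappa1 mulr1 e1 scale1r.
  + by rewrite big_seq1 wkappa1 mulr1 e1 scale1r.
- exists (s ++ s'); rewrite /tens !big_cat/= ks ks' sk sk' (wcoef_linearD e_linear)//.
  split; rewrite ?scalerDl//.
  + by move=> x; rewrite mem_cat => /orP[/sw|/s'w].
  + by rewrite rmorphD /= as_ bs'.
- exists [seq (c *: x.1, x.2) | x <- s]; split.
  + by move=> x /mapP[y /sw[y1 y2] ->]; split=> //; apply: wcoefZ.
  + rewrite linearZ /= as_ /tens big_map scaler_sumr.
    by apply: eq_bigr => x _; rewrite linearZ /= scalerAl.
  + rewrite big_map (wcoef_linearZ e_linear)// -scalerA -ks scaler_sumr 2!big_seq.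
    apply: eq_bigr => x /sw[x1 x2] /=.
    by rewrite (wcoef_linearZ wkappa_wcoef_linear)// scalerAl.
  + rewrite big_map (wcoef_linearZ e_linear)// -scalerA -sk scaler_sumr.
    by apply: eq_bigr => x _; rewrite scalerAl.
- have [[_ _ lrC _] _ _] := wtensorP W.
  exists [seq (x.1 * y.1, x.2 * y.2) | x <- s, y <- s']; split.
  + move=> _ /allpairsP[[x y] [/sw[x1 x2] /s'w[y1 y2] ->]].
    by split; apply: wcoefM.
  + rewrite rmorphM /= as_ bs' /tens big_allpairs_dep mulr_suml.
    apply: eq_bigr => x _; rewrite mulr_sumr; apply: eq_bigr => y _ /=.
    by rewrite !rmorphM /= -!mulrA; congr (_ * _); rewrite !mulrA lrC.
  (* In [kappa y.1 * kappa x.1 * x.2 * y.2] the inner pair belongs to [a], so the sum over [s] is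
     performed first. *)
  + rewrite big_allpairs_dep exchange_big /= eM//.
    transitivity (\sum_(y <- s') kappa y.1 * (e a)%:A * y.2).
      rewrite 2!big_seq; apply: eq_bigr => y /s'w[y1 y2].
      rewrite -ks mulr_sumr mulr_suml 2!big_seq; apply: eq_bigr => x /sw[x1 x2].
      by rewrite /= /kappa wkappaM// !mulrA.
    rewrite -scalerA -ks' scaler_sumr.
    by apply: eq_bigr => y _; rewrite mulr_algr scalerAl.
  + rewrite big_allpairs_dep /= eM//.
    transitivity (\sum_(x <- s) x.1 * (e b)%:A * kappa x.2).
      rewrite 2!big_seq; apply: eq_bigr => x /sw[x1 x2].
      rewrite -sk' mulr_sumr mulr_suml 2!big_seq; apply: eq_bigr => y /s'w[y1 y2].
      by rewrite /= /kappa wkappaM// !mulrA.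
    rewrite mulrC -scalerA -sk scaler_sumr.
    by apply: eq_bigr => x _; rewrite mulr_algr scalerAl.
- have [[lstar rstar lrC _] _ _] := wtensorP W.
  have kw (b : A) : wcoef b -> wcoef (star (kappa (star b))).
    by move=> bw; apply/wcoef_star/wkappa_coef/wcoef_star.
  exists [seq (star x.1, star x.2) | x <- s]; split.
  + by move=> x /mapP[y /sw[y1 y2] ->]; split; apply: wcoef_star.
  + rewrite wdelta_star as_ /tens big_map star_sum; apply: eq_bigr => x _.
    by rewrite lrC starM lstar rstar.
  + rewrite big_map e_star//=.
    have -> : \sum_(x <- s) kappa (star x.1) * star x.2 =
        star (\sum_(x <- s) x.2 * star (kappa (star x.1))).
      by rewrite star_sum; apply: eq_bigr => x _; rewrite starM starK.
    apply: kappa_inj_scalar.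
      by apply: wcoef_sum => x /sw[x1 x2]; apply: wcoefM => //; apply: kw.
    rewrite conjCK -sk (wcoef_linear_sum wkappa_wcoef_linear).
      rewrite 2!big_seq; apply: eq_bigr => x /sw[x1 x2].
      by rewrite /kappa wkappaM ?wkappa_star//; apply: kw.
    by move=> x /sw[x1 x2]; apply: wcoefM => //; apply: kw.
  + rewrite big_map e_star//=.
    have -> : \sum_(x <- s) star x.1 * kappa (star x.2) =
        star (\sum_(x <- s) star (kappa (star x.2)) * x.1).
      by rewrite star_sum; apply: eq_bigr => x _; rewrite starM starK.
    apply: kappa_inj_scalar.
      by apply: wcoef_sum => x /sw[x1 x2]; apply: wcoefM => //; apply: kw.
    rewrite conjCK -ks (wcoef_linear_sum wkappa_wcoef_linear).
      rewrite 2!big_seq; apply: eq_bigr => x /sw[x1 x2].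
      by rewrite /kappa wkappaM ?wkappa_star//; apply: kw.
    by move=> x /sw[x1 x2]; apply: wcoefM => //; apply: kw.
Qed.

Lemma antipodel a s : wcoef_legs s -> wdelta W a = tens (winl W) (winr W) s ->
  wcoef a -> \sum_(x <- s) kappa x.1 * x.2 = (e a)%:A.
Proof.
move=> sw as_ /antipode_exists[s' [s'w as' <- _]].
by apply: (eq_tens_bilinear wcoef_bilinear_kappal) => //; rewrite -as_.
Qed.

Lemma antipoder a s : wcoef_legs s -> wdelta W a = tens (winl W) (winr W) s ->
  wcoef a -> \sum_(x <- s) x.1 * kappa x.2 = (e a)%:A.
Proof.
move=> sw as_ /antipode_exists[s' [s'w as' _ <-]].
by apply: (eq_tens_bilinear wcoef_bilinear_kappar) => //; rewrite -as_.
Qed.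

Context {m : nat} {v : 'M[A]_m}.
Hypothesis vP : unitary_corep v.
Hypothesis e_v : map_mx e v = 1%:M.

Let e_vE i j : e (v i j) = (i == j)%:R.
Proof. by have := congr1 (fun x : 'M[C]__ => x i j) e_v; rewrite !mxE. Qed.

(** The antipode identity makes [kappa(v)] a left inverse of [v], and [v] is unitary. *)
Lemma map_kappa_corep : map_mx kappa v = star_mx v.
Proof.
have [vw [vv' _] _] := vP.
rewrite -[LHS]mulmx1 -vv' mulmxA -[RHS]mul1mx; congr (_ *m _).
apply/matrixP => i j.
have sw : wcoef_legs [seq (v i k, v k j) | k <- enum 'I_m].
  by move=> x /mapP[k _ ->]; split; apply: vw.
have := antipodel sw (tens_map_corep i j vP) (vw i j).
rewrite big_map big_enum /= e_vE scaler_nat => kvv.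
by rewrite !mxE -[RHS]kvv; apply: eq_bigr => k _; rewrite !mxE.
Qed.

Let kappa2 : 'M[A]_m := map_mx (kappa \o kappa) v.

Lemma kappa_star_corep k j : kappa (star (v k j)) = kappa2 j k.
Proof.
rewrite mxE /=; congr (kappa _).
by have := congr1 (fun x : 'M[A]__ => x j k) map_kappa_corep; rewrite !mxE.
Qed.

Let conj_legs i j : wcoef_legs [seq (star (v i k), star (v k j)) | k <- enum 'I_m].
Proof.
by move=> x /mapP[k _ ->]; have [vw _ _] := vP; split; apply/wcoef_star/vw.
Qed.

Let conj_delta i j : wdelta W (star (v i j)) =
  tens (winl W) (winr W) [seq (star (v i k), star (v k j)) | k <- enum 'I_m].
Proof.
have [_ _ vd] := vP; have [[lstar rstar lrC _] _ _] := wtensorP W.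
rewrite wdelta_star vd /tens big_map big_enum star_sum; apply: eq_bigr => k _.
by rewrite lrC starM lstar rstar.
Qed.

(** This is the antipode identity for the coefficients of the conjugate of [v], since [kappa] sends
    [star (v k j)] to [kappa^2 (v j k)]. The conjugate need not be unitary; its inverse is what the
    canonical dual corrects for. *)
Lemma conj_corep_mulr : map_mx star v *m kappa2^T = 1%:M.
Proof.
have [vw _ _] := vP; apply/matrixP => i j.
have := antipoder (@conj_legs i j) (conj_delta i j) (wcoef_star (vw i j)).
rewrite big_map big_enum /= e_star// e_vE conjC_nat scaler_nat => vE.
rewrite [RHS]mxE -[RHS]vE mxE; apply: eq_bigr => k _.
by rewrite kappa_star_corep [kappa2 _ _]mxE !mxE.
Qed.

Lemma conj_corep_mull : kappa2^T *m map_mx star v = 1%:M.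
Proof.
have [vw _ _] := vP; apply/matrixP => i j.
have := antipodel (@conj_legs i j) (conj_delta i j) (wcoef_star (vw i j)).
rewrite big_map big_enum /= e_star// e_vE conjC_nat scaler_nat => vE.
rewrite [RHS]mxE -[RHS]vE mxE; apply: eq_bigr => k _.
by rewrite kappa_star_corep [kappa2 _ _]mxE !mxE.
Qed.

End Antipode.

(** * Modular data of a corepresentation *)

Section ModularCorepresentation.
Context {R : realType} {W : woronowicz_algebra R}.
Let C := R[i].
Let A := walg W.
Context {h : {scalar A}} {f : C -> A -> C}.
Hypothesis fP : is_woronowicz_characters h f.

Let f_linear z : wcoef_linear (f z : A -> C^o).
Proof. by case: (fP.1 z). Qed.

Lemma map_char_mulmx z m n p q (S : 'M[C]_(m, n)) (x : 'M[A]_(n, p)) (T : 'M[C]_(p, q)) :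
  (forall i j, wcoef (x i j)) ->
  map_mx (f z) (scal_mx A S *m x *m scal_mx A T) = S *m map_mx (f z) x *m T.
Proof.
move=> xw; apply/matrixP => i j.
have Sxw k : wcoef ((scal_mx A S *m x) i k).
  by rewrite mxE; apply: wcoef_sum => l _; rewrite mxE mulr_algl; apply: wcoefZ.
rewrite mxE mxE (wcoef_linear_sum (f_linear z)) => [|k _]; last first.
  by rewrite [scal_mx _ _ _ _]mxE mulr_algr; apply: wcoefZ.
rewrite [RHS]mxE; apply: eq_bigr => k _.
rewrite [scal_mx _ _ _ _]mxE mulr_algr (wcoef_linearZ (f_linear z))// mulrC.
rewrite /GRing.scale /=; congr (_ * _).
rewrite mxE (wcoef_linear_sum (f_linear z)) => [|l _]; last first.
  by rewrite mxE mulr_algl; apply: wcoefZ.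
rewrite mxE; apply: eq_bigr => l _.
by rewrite !mxE mulr_algl (wcoef_linearZ (f_linear z)).
Qed.

Lemma map_char_tens z m n (v : 'M[A]_m) (w : 'M[A]_n) :
  (forall i j, wcoef (v i j)) -> (forall i j, wcoef (w i j)) ->
  map_mx (f z) (v *t w) = map_mx (f z) v *t map_mx (f z) w.
Proof.
move=> vw ww; apply/matrixP => i j; rewrite !mxE.
by case: (fP.1 z) => _ _ ->.
Qed.

Let bil_l z : wcoef_bilinear (fun a b : A => f z b *: a).
Proof.
split=> a aw c b d bw dw /=; first by rewrite scalerDr !scalerA mulrC.
by case: (fP.1 z) => _ -> // _; rewrite scalerDl scalerA.
Qed.

Let bil_r z : wcoef_bilinear (fun a b : A => f z a *: b).
Proof.
split=> a aw c b d bw dw /=.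
  by case: (fP.1 z) => _ -> // _; rewrite scalerDl scalerA.
by rewrite scalerDr !scalerA mulrC.
Qed.

Let bil_lr z z' : wcoef_bilinear (fun a b : A => f z a * f z' b : C^o).
Proof.
split=> a aw c b d bw dw /=.
  by case: (fP.1 z) => _ -> // _; rewrite mulrDl -mulrA.
by case: (fP.1 z') => _ -> // _; rewrite mulrDr mulrCA.
Qed.

Section OneCorepresentation.
Context {m : nat} {v : 'M[A]_m}.
Hypothesis vP : unitary_corep v.
Let F z := map_mx (f z) v.

Let vw i j : wcoef (v i j). Proof. by case: vP. Qed.

(** With [z' = 1], the value [z = -1] computes [kappa^2] on [v], and [z = 1] the modular twist of
    the Haar measure. *)
Lemma conv_lr_corep z z' i j :
  conv_l (f z) (conv_r (v i j) (f z')) = (scal_mx A (F z') *m v *m scal_mx A (F z)) i j.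
Proof.
rewrite /conv_r (sum_comult_corep i j vP (bil_r z')) /conv_l.
rewrite (sum_comult_corep_lin _ j vP (bil_l z)) mxE.
under eq_bigr do rewrite scaler_sumr.
rewrite exchange_big /=; apply: eq_bigr => l _.
rewrite mxE mulr_suml; apply: eq_bigr => k _.
by rewrite !mxE mulr_algl mulr_algr !scalerA mulrC.
Qed.

Lemma map_counit : F 0 = 1%:M.
Proof.
have [_ [vv' v'v] _] := vP.
have vF : v *m scal_mx A (F 0) = v.
  apply/matrixP => i j; have [[_ _ _ + _] _] := fP.2 _ (vw i j).
  rewrite /conv_l (sum_comult_corep i j vP (bil_l 0)) => vE.
  by rewrite -[RHS]vE mxE; apply: eq_bigr => k _; rewrite !mxE mulr_algr.
apply: (@scal_mx_inj _ A); rewrite scal_mx1.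
by rewrite -[LHS]mul1mx -v'v -mulmxA vF.
Qed.

Lemma map_charD z z' : F z *m F z' = F (z + z').
Proof.
apply/matrixP => i j; have [[_ _ + _ _] _] := fP.2 _ (vw i j).
move=> /(_ z z'); rewrite /conv (sum_comult_corep i j vP (bil_lr z z')) => vE.
by rewrite [RHS]mxE -vE mxE; apply: eq_bigr => k _; rewrite !mxE.
Qed.

Lemma map_charN z : F z *m F (- z) = 1%:M.
Proof. by rewrite map_charD subrr map_counit. Qed.

Lemma map_char_star z : F z *m map_mx (f z) (star_mx v) = 1%:M.
Proof.
have [_ [vv' _] _] := vP.
apply/matrixP => i j; rewrite mxE.
have := congr1 (fun x : 'M[A]__ => f z (x i j)) vv'; rewrite [in RHS]mxE mxE.
rewrite (wcoef_linear_sum (f_linear z)) => [|k _]; last first.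
  by rewrite !mxE; apply: wcoefM => //; apply: wcoef_star.
have -> : f z (1 *+ (i == j)) = (1%:M : 'M[C]_m) i j.
  rewrite mxE; case: (i == j) => /=; last by rewrite mulr0n (wcoef_linear0 (f_linear z)).
  by case: (fP.1 z).
move=> <-; apply: eq_bigr => k _; case: (fP.1 z) => _ _ fM.
by rewrite !mxE fM//; apply: wcoef_star.
Qed.

(** Applying [f z] to [v v^* = 1] shows that [f z] sends [v^*] to [F (- z)]; the rule for
    [f z (star a)] expresses the same matrix as an adjoint. *)
Lemma adj_map_char z : adj_mx (F z) = F (Num.conj z).
Proof.
have star_eq : map_mx (f (- Num.conj z)) (star_mx v) = F (Num.conj z).
  have := map_charN (- Num.conj z); rewrite opprK => Fz.
  have Fz' := mulmx1C Fz.
  by rewrite -[LHS]mul1mx -Fz' -mulmxA map_char_star mulmx1.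
rewrite -star_eq; apply/matrixP => i j; rewrite !mxE.
have [_ [_ -> _ _]] := fP.2 _ (vw j i).
by rewrite rmorphN /= opprK conjCK.
Qed.

(** Apply [h] to [v v^* = 1] and move the left factor to the right by modularity: this gives
    [F 1 *m X = 1], so [X] is [F (- 1)]. In the trace of [X] the sum over [p] produces [h] of the
    entries of [v^* v = 1], and only [\tr (F 1)] remains. *)
Lemma mxtrace_map_char : h 1 = 1 -> \tr (F 1) = \tr (F (- 1)).
Proof.
move=> h1; have [_ [vv' v'v] _] := vP.
pose X : 'M[C]_m := \matrix_(p, k) \sum_j \sum_q F 1 q j * h (star (v k j) * v p q).
have FX : F 1 *m X = 1%:M.
  apply/matrixP => i k; have := congr1 (fun x : 'M[A]__ => h (x i k)) vv'.
  rewrite [in RHS]mxE mxE linear_sum.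
  have -> : h (1 *+ (i == k)) = (1%:M : 'M[C]_m) i k.
    by rewrite mxE; case: (i == k); rewrite ?mulr0n ?linear0.
  move=> <-; rewrite mxE.
  transitivity (\sum_p \sum_j \sum_q F 1 i p * (F 1 q j * h (star (v k j) * v p q))).
    apply: eq_bigr => p _; rewrite [X _ _]mxE mulr_sumr.
    by apply: eq_bigr => j _; rewrite mulr_sumr.
  rewrite exchange_big /=; apply: eq_bigr => j _.
  have [_ [_ _ _ hE]] := fP.2 _ (vw i j).
  have -> : star_mx v j k = star (v k j) by rewrite !mxE.
  rewrite hE; last exact: wcoef_star.
  rewrite conv_lr_corep mxE mulr_sumr linear_sum exchange_big /=.
  apply: eq_bigr => q _.
  rewrite [(scal_mx A (F 1) *m v) i q]mxE mulr_suml mulr_sumr linear_sum.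
  apply: eq_bigr => p _.
  rewrite !mxE mulr_algl mulr_algr -!scalerAr !linearZ /=.
  by rewrite mulrCA.
have -> : F (- 1) = X by rewrite -[LHS]mulmx1 -FX mulmxA (mulmx1C (map_charN 1)) mul1mx.
have hv j q : \sum_p h (star (v p j) * v p q) = (j == q)%:R.
  rewrite -linear_sum; have := congr1 (fun x : 'M[A]__ => h (x j q)) v'v.
  rewrite [in RHS]mxE mxE.
  under eq_bigr do rewrite !mxE.
  by move=> ->; case: (j == q); rewrite ?mulr0n ?linear0.
rewrite /mxtrace [RHS](eq_bigr (fun p => \sum_j \sum_q F 1 q j * h (star (v p j) * v p q))).
  rewrite exchange_big /=; apply: eq_bigr => j _.
  rewrite exchange_big /= (bigD1 j)//= [X in _ + X]big1 => [|q /negbTE qj].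
    by rewrite -mulr_sumr hv eqxx mulr1 addr0.
  by rewrite -mulr_sumr hv eq_sym qj mulr0.
by move=> p _; rewrite mxE.
Qed.

End OneCorepresentation.

End ModularCorepresentation.

(** * The canonical dual and the words in the two letters *)

Section DualCorepresentation.
Context {R : realType} {W : woronowicz_algebra R}.
Let C := R[i].
Let A := walg W.
Context {h : {scalar A}} {f : C -> A -> C} {m : nat} {v : 'M[A]_m}.
Hypothesis fP : is_woronowicz_characters h f.
Hypothesis vP : unitary_corep v.

Let vw i j : wcoef (v i j). Proof. by case: vP. Qed.

(** Transposition reverses this product over a noncommutative [A] because the outer factors are
    scalar. *)
Lemma trmx_scal_mulmx m1 m2 m3 m4 (S : 'M[C]_(m1, m2)) (x : 'M[A]_(m2, m3))
    (T : 'M[C]_(m3, m4)) :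
  (scal_mx A S *m x *m scal_mx A T)^T =
  scal_mx A T^T *m x^T *m scal_mx A S^T.
Proof.
apply/matrixP => i j; rewrite [LHS]mxE [LHS]mxE [RHS]mxE.
under eq_bigr do rewrite mxE mulr_suml.
rewrite exchange_big /=; apply: eq_bigr => k _.
rewrite [X in _ = X * _]mxE mulr_suml; apply: eq_bigr => l _.
by rewrite !mxE !mulr_algl !mulr_algr !scalerA mulrC.
Qed.

Let Q := qmat f v.
Let S := map_mx (f (- 2^-1)) v.

Let conj_half : Num.conj (2^-1 : C) = 2^-1.
Proof. by rewrite fmorphV /= conjC_nat. Qed.

Lemma qmat_adj : adj_mx Q = Q.
Proof. by rewrite /Q /qmat (adj_map_char fP vP) conj_half. Qed.

Let S_adj : adj_mx S = S.
Proof. by rewrite /S (adj_map_char fP vP) rmorphN /= conj_half. Qed.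

Let QS : Q *m S = 1%:M.
Proof. exact: (map_charN fP vP). Qed.

Let SQ : S *m Q = 1%:M. Proof. exact: mulmx1C QS. Qed.

Lemma qmat_unit : Q \in unitmx.
Proof. by case/mulmx1_unit: QS. Qed.

Let invQ : invmx Q = S.
Proof. by rewrite -[LHS]mulmx1 -QS mulmxA mulVmx ?qmat_unit// mul1mx. Qed.

Lemma qmat_mulmx : Q *m Q = map_mx (f 1) v.
Proof. by rewrite (map_charD fP vP) -div1r -splitr. Qed.

Let SS : S *m S = map_mx (f (- 1)) v.
Proof. by rewrite (map_charD fP vP) -opprD -div1r -splitr. Qed.

Lemma wu_unitary_corep : unitary_corep (wu W).
Proof.
split; [|exact: wu_unitary|exact: wdeltaE].
by move=> i j; apply: SpanGen; exists i, j.
Qed.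

Let counit_star a : wcoef a -> f 0 (star a) = Num.conj (f 0 a).
Proof. by move=> aw; have [_ [_ -> _ _]] := fP.2 _ aw; rewrite conjC0 oppr0. Qed.

Let kappa2 : map_mx (@wkappa _ W \o @wkappa _ W) v =
  scal_mx A (Q *m Q) *m v *m scal_mx A (S *m S).
Proof.
apply/matrixP => i j; rewrite mxE /=; have [_ [_ _ -> _]] := fP.2 _ (vw i j).
by rewrite (conv_lr_corep fP vP) qmat_mulmx SS.
Qed.

Let scalM := @scal_mxM C A.

Let conj_mulr :
  map_mx star v *m (scal_mx A (S^T *m S^T) *m v^T *m scal_mx A (Q^T *m Q^T)) = 1%:M.
Proof.
have [f1 fl fM] := fP.1 0.
rewrite -!trmx_mul -trmx_scal_mulmx -kappa2.
exact: (conj_corep_mulr fl fM f1 counit_star (map_counit fP wu_unitary_corep) vP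
  (map_counit fP vP)).
Qed.

Let conj_mull :
  scal_mx A (S^T *m S^T) *m v^T *m scal_mx A (Q^T *m Q^T) *m map_mx star v = 1%:M.
Proof.
have [f1 fl fM] := fP.1 0.
rewrite -!trmx_mul -trmx_scal_mulmx -kappa2.
exact: (conj_corep_mull fl fM f1 counit_star (map_counit fP wu_unitary_corep) vP
  (map_counit fP vP)).
Qed.

Let QSt : Q^T *m S^T = 1%:M. Proof. by rewrite -trmx_mul SQ trmx1. Qed.
Let SQt : S^T *m Q^T = 1%:M. Proof. by rewrite -trmx_mul QS trmx1. Qed.

Let dualE : dual_corep f v = scal_mx A Q^T *m map_mx star v *m scal_mx A S^T.
Proof. by rewrite /dual_corep -trmx_inv invQ. Qed.

Let adjT n (x : 'M[C]_n) : adj_mx x = x -> adj_mx x^T = x^T.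
Proof. by move=> xx; rewrite -{2}xx; apply/matrixP => i j; rewrite !mxE. Qed.

Let star_dual : star_mx (dual_corep f v) = scal_mx A S^T *m v^T *m scal_mx A Q^T.
Proof.
rewrite dualE !star_mxM !star_scal_mx !adjT ?qmat_adj// mulmxA; congr (_ *m _ *m _).
by apply/matrixP => i j; rewrite !mxE starK.
Qed.

Let scalQSt : scal_mx A Q^T *m scal_mx A S^T = 1%:M.
Proof. by rewrite -scalM QSt scal_mx1. Qed.

Let scalSQt : scal_mx A S^T *m scal_mx A Q^T = 1%:M.
Proof. by rewrite -scalM SQt scal_mx1. Qed.

(** The inverse of the conjugate of [v], with its [Q^T] factors moved to the other side. Half of the
    unitarity of the dual, and the fixed vector of the even letters, reduce to this form. *)
Let conj_SS : map_mx star v *m scal_mx A S^T *m scal_mx A S^T *m v^T =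
  scal_mx A S^T *m scal_mx A S^T.
Proof.
have := congr1 (mulmx^~ (scal_mx A S^T *m scal_mx A S^T)) conj_mulr.
rewrite mul1mx !scalM !mulmxA => <-.
rewrite -[_ *m scal_mx A Q^T *m scal_mx A S^T]mulmxA scalQSt mulmx1.
by rewrite -[_ *m scal_mx A Q^T *m scal_mx A S^T]mulmxA scalQSt mulmx1.
Qed.

Let conj_QQ : v^T *m scal_mx A Q^T *m scal_mx A Q^T *m map_mx star v =
  scal_mx A Q^T *m scal_mx A Q^T.
Proof.
have := congr1 (mulmx (scal_mx A Q^T *m scal_mx A Q^T)) conj_mull.
rewrite mulmx1 !scalM !mulmxA => <-.
by rewrite -[_ *m scal_mx A Q^T *m scal_mx A S^T]mulmxA scalQSt mulmx1 scalQSt mul1mx.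
Qed.

Lemma dual_unitary : unitary_mx (dual_corep f v).
Proof.
split; rewrite star_dual dualE.
- rewrite !mulmxA.
  have -> : scal_mx A Q^T *m map_mx star v *m scal_mx A S^T *m scal_mx A S^T *m v^T =
      scal_mx A Q^T *m (map_mx star v *m scal_mx A S^T *m scal_mx A S^T *m v^T).
    by rewrite !mulmxA.
  by rewrite conj_SS mulmxA scalQSt mul1mx scalSQt.
- rewrite !mulmxA.
  have -> : scal_mx A S^T *m v^T *m scal_mx A Q^T *m scal_mx A Q^T *m map_mx star v =
      scal_mx A S^T *m (v^T *m scal_mx A Q^T *m scal_mx A Q^T *m map_mx star v).
    by rewrite !mulmxA.
  by rewrite conj_QQ mulmxA scalSQt mul1mx scalQSt.
Qed.

(** [f_{1/2}] sends the conjugate of [v] to the conjugate of [S], which is [S^T] as [S] is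
    self-adjoint; conjugation by [Q^T] leaves it unchanged. *)
Lemma qmat_dual : qmat f (dual_corep f v) = S^T.
Proof.
rewrite /qmat dualE (map_char_mulmx fP) => [|i j]; last by rewrite mxE; apply/wcoef_star/vw.
suff -> : map_mx (f 2^-1) (map_mx star v) = S^T by rewrite QSt mul1mx.
apply/matrixP => i j; rewrite !mxE.
have [_ [_ -> _ _]] := fP.2 _ (vw i j); rewrite conj_half.
by have := congr1 (fun x : 'M[C]__ => x j i) S_adj; rewrite !mxE.
Qed.

Lemma letter_unitary p : unitary_mx (letter f v p).
Proof.
rewrite /letter; case: (odd p); last exact: dual_unitary.
by case: vP.
Qed.

(** After cancelling [Q] against [S], the odd letters only require [v v^* = 1]; the even ones are
    [conj_SS]. *)
Lemma letter_fixed p : letter f v p *m scal_mx A (qmat f (letter f v p)) *m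
  (letter f v p.+1)^T = scal_mx A (qmat f (letter f v p)).
Proof.
rewrite /letter /=; case: (odd p) => /=.
  rewrite dualE trmx_scal_mulmx !trmxK -/Q !mulmxA -[v *m _ *m _]mulmxA -scalM QS.
  rewrite scal_mx1 mulmx1; have [_ [vv' _] _] := vP.
  by rewrite -/(star_mx v) vv' mul1mx.
rewrite qmat_dual dualE.
have -> : scal_mx A Q^T *m map_mx star v *m scal_mx A S^T *m scal_mx A S^T *m v^T =
    scal_mx A Q^T *m (map_mx star v *m scal_mx A S^T *m scal_mx A S^T *m v^T).
  by rewrite !mulmxA.
by rewrite conj_SS mulmxA scalQSt mul1mx.
Qed.

Lemma letter_wcoef p i j : wcoef (letter f v p i j).
Proof.
rewrite /letter; case: (odd p) => //; rewrite dualE mxE.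
apply: wcoef_sum => k _; rewrite [scal_mx _ _ _ _]mxE mulr_algr; apply: wcoefZ.
rewrite mxE; apply: wcoef_sum => l _; rewrite !mxE mulr_algl.
exact/wcoefZ/wcoef_star.
Qed.

Lemma qmat_letter_adj p : adj_mx (qmat f (letter f v p)) = qmat f (letter f v p).
Proof.
rewrite /letter; case: (odd p); first exact: qmat_adj.
by rewrite qmat_dual adjT.
Qed.

Lemma qmat_letter_unit p : qmat f (letter f v p) \in unitmx.
Proof.
rewrite /letter; case: (odd p); first exact: qmat_unit.
by rewrite qmat_dual; case/mulmx1_unit: QSt.
Qed.

Let w j : 'M[A]_(word_dim m 0 j) := word_corep f v 0 j.

Lemma word_corep_wcoef j i k : wcoef (w j i k).
Proof.
elim: j i k => [|j IHj] i k.
  by rewrite /w /= mxE; case: (i == k); [apply: wcoef1 | rewrite mulr0n; apply: wcoef0].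
rewrite [w j.+1 _ _]mxE; apply: wcoefM; first exact: IHj.
exact: letter_wcoef.
Qed.

Lemma qmat_word_succ j :
  qmat f (w j.+1) = qmat f (w j) *t qmat f (letter f v j.+1).
Proof.
apply: (map_char_tens fP); [exact: word_corep_wcoef | exact: letter_wcoef].
Qed.

Lemma qmat_word0 : qmat f (w 0) = 1%:M.
Proof.
apply/matrixP => i k; rewrite !ord1 !mxE eqxx.
by case: (fP.1 2^-1).
Qed.

Lemma qmat_word_adj j : adj_mx (qmat f (w j)) = qmat f (w j).
Proof.
elim: j => [|j IHj]; first by rewrite qmat_word0 adj_mx1.
by rewrite qmat_word_succ adj_mx_tens IHj qmat_letter_adj.
Qed.

Lemma qmat_word_unit j : qmat f (w j) \in unitmx.
Proof.
elim: j => [|j IHj]; first by rewrite qmat_word0 unitmx1.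
rewrite qmat_word_succ; set G := qmat f (letter f v j.+1).
have /mulmx1_unit[] // : (qmat f (w j) *t G) *m (invmx (qmat f (w j)) *t invmx G) = 1%:M.
rewrite tensmx_mul !mulmxV ?qmat_letter_unit//; apply/matrixP => i k.
case: i / (mxtens_indexP i) => a b; case: k / (mxtens_indexP k) => c d.
by rewrite tensmxE !mxE -natrM mulnb (can_eq (@mxtens_indexK _ _)).
Qed.

(** Apply the character [f_{1/2}] entrywise to the intertwining relation. As a consequence
    [Tr (Q^2 .)] is a trace on the endomorphism algebra. *)
Lemma qmat_word_comm j x :
  corep_hom (w j) (w j) x -> qmat f (w j) *m x = x *m qmat f (w j).
Proof.
rewrite /corep_hom /= => /(congr1 (map_mx (f 2^-1))) xw.
have := map_char_mulmx fP 2^-1 x 1%:M (@word_corep_wcoef j).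
have := map_char_mulmx fP 2^-1 1%:M x (@word_corep_wcoef j).
by rewrite !scal_mx1 !mulmx1 !mul1mx xw => -> ->.
Qed.

Lemma principal_graph_norm_le :
  (graph_norm R (principal_graph (popa_system f v)) <= (m%:R : R)%:E)%E.
Proof.
apply: graph_norm_principal_le.
- exact: letter_unitary.
- exact: letter_fixed.
- exact: qmat_word_comm.
- exact: qmat_word_adj.
- exact: qmat_word_unit.
- exact: qmat_word_succ.
- exact: qmat_letter_adj.
Qed.

Lemma le_qdim : h 1 = 1 -> m%:R <= qdim f v.
Proof.
move=> h1; have trF := mxtrace_map_char fP vP h1.
rewrite -qmat_mulmx -SS in trF.
have := mxtrace_mulmx_adj_ge0 (Q - S).
rewrite adj_mxB qmat_adj S_adj mulmxBl !mulmxBr QS SQ.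
rewrite !linearB /= !mxtrace1 -trF -/Q => tr_ge0.
have : m%:R <= \tr (Q *m Q).
  move: tr_ge0; set t := \tr _ => tr_ge0.
  have {}tr_ge0 : 0 <= (t - m%:R) *+ 2.
    by rewrite mulr2n; move: tr_ge0; rewrite opprK [_ + t]addrC.
  by rewrite -subr_ge0; rewrite pmulrn_lge0 in tr_ge0.
rewrite /qdim -/Q; case: (\tr (Q *m Q)) => re im.
by rewrite -(rmorph_nat (real_complex R)) lecE /= => /andP[].
Qed.

End DualCorepresentation.

Theorem corollary6p1 (R : realType) (W : woronowicz_algebra R)
    (h : {scalar walg W}) (f : R[i] -> walg W -> R[i])
    (m : nat) (v : 'M[walg W]_m) :
  is_haar h ->
  is_woronowicz_characters h f ->
  unitary_corep v ->
  amenable (popa_system f v) ->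
  exists n : nat, popa_index (popa_system f v) = n%:R ^+ 2.
Proof.
move=> [h1 _ _ _] fP vP amen; exists m.
have m_le := le_qdim fP vP h1.
have := principal_graph_norm_le fP vP; rewrite amen lee_fin /=.
(* The norm prescribed by amenability is the absolute value of [qdim f v], which is nonnegative
   because it is at least [m]. *)
rewrite sqrtrV ?sqr_ge0// invrK sqrtr_sqr ger0_norm; last exact: le_trans m_le.
move=> le_m; rewrite /popa_index /= invrK; congr (_ ^+ 2).
by apply/eqP; rewrite eq_le le_m m_le.
Qed.
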